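(* Let $\frac16 < \rho < \frac{2}{11}$. Let $V \ge 1$, $W \ge 1$ satisfy \[ V^3W^2 \ll N^{2-3\rho}, \qquad VW^3 \ll N^{3-15\rho/2}, \qquad VW \ll N^{2-8\rho}. \] Let \[ T := \sum_{\ell=1}^{L} \sum_{v \sim V} \sum_{w \sim W} \Big| \sum_{n \in I(vw)} e(\ell g(vwn)) \Big|, \] where for each pair $(v,w)$, $I(vw)$ is an arbitrary subinterval of $\left(\frac{N}{2vw}, \frac{N}{vw}\right]$. Then $T \ll N^{1-10\eta}$.
   Context: Fix real numbers $\alpha,\beta,\gamma$ with $\alpha$ irrational. Let $\varepsilon>0$ be a sufficiently small fixed number and $\eta=\varepsilon^9$. Let $a/q$ be a fraction in lowest terms with $|\alpha - a/q| < q^{-2}$, with $q$ sufficiently large, and set $g(x) = \frac{a}{q}x^2 + \beta x + \gamma$. Put $L_1 = 2N^{\rho - \varepsilon/2}$, where $N$ is chosen so that $L_1^{1/2}N \ll q \ll L_1^{1/2} N$, and put $L = N^{\rho - \varepsilon/3}$. Write $e(\theta)=e^{2\pi i\theta}$; $y \sim Y$ means $Y < y \le 2Y$ (and $v,w$ range over integers). The notation $A \ll B$ means $|A| \le CB$ with $C$ depending at most on $\varepsilon$ (uniformly in $q$, $N$ and the choice of intervals). *)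

(* Defs.v *)
From mathcomp Require Import all_boot all_order all_algebra.
From mathcomp Require Import complex.
From mathcomp Require Import all_classical all_reals all_analysis.

Set Implicit Arguments.
Unset Strict Implicit.
Unset Printing Implicit Defensive.

Import Order.TTheory GRing.Theory Num.Theory.
Local Open Scope ring_scope.

(* [vino C A B] is the bound A << B with its implied constant C displayed; the
   dependence of C on other parameters is fixed by where it is quantified. *)
Definition vino (R : realType) (C A B : R) : Prop := `|A| <= C * B.

Definition expe (R : realType) (t : R) : R[i] :=
  (cos (2 * pi * t) +i* sin (2 * pi * t))%C.

(* y ~ Y *)
Definition dyadic (R : realType) (Y : R) (y : nat) : bool :=
  Y < y%:R <= 2 * Y.

Definition quad (R : realType) (A beta gamma x : R) : R :=
  A * x ^+ 2 + beta * x + gamma.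

(* The sum of f(n) over the integers 1 <= n <= B lying in the interval J; it
   is used with J a subset of ]0, B], so the cut-off at B loses nothing. *)
Definition isum (R : realType) (B : R) (J : interval R) (f : nat -> R[i])
  : R[i] :=
  \sum_(1 <= n < (Num.truncn B).+1 | n%:R \in J) f n.

(* Every v ~ V, w ~ W is a positive integer when V, W >= 1, so summing over
   natural numbers up to floor(2V), floor(2W) loses nothing. *)
Definition Tsum (R : realType) (g : R -> R) (N L V W : R)
    (I : nat -> nat -> interval R) : R :=
  \sum_(1 <= l < (Num.truncn L).+1)
   \sum_(0 <= v < (Num.truncn (2 * V)).+1 | dyadic V v)
    \sum_(0 <= w < (Num.truncn (2 * W)).+1 | dyadic W w)
      Normc.normc (isum (N / (v * w)%:R) (I v w)
        (fun n => expe (l%:R * g (v * w * n)%:R))).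

(* Main.v *)
Require Import Defs.
From mathcomp Require Import all_boot all_order all_algebra zify ring lra complex.
From mathcomp Require Import all_classical all_reals all_analysis.

Set Implicit Arguments.
Unset Strict Implicit.
Unset Printing Implicit Defensive.

Import Order.TTheory GRing.Theory Num.Theory.

(* Write M = VW, X = N / M, om = N^(eps/100), and |x| for the distance of x to the nearest
   integer.  Fix v, w, put x = a v^2 w^2 / q and let b/s be a Dirichlet approximation of x.
   Weyl differencing, summed over l with the divisor bound, gives
   sum_l |S_l| << om^2 X (L / X^(1/2) + L / t^(1/2)), where t = max (s, L X^2 |s x|).  The bound
   on VW and rho > 1/6 make the first term admissible, so it suffices to show that, for
   tau << L om^5, at most M tau / (L om^6) pairs (v, w) have some s <= tau^2 with
   |s v^2 w^2 a/q| <= tau^2 M^2 / q^2.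

   For fixed w consider all y <= 4 tau^2 V^2 in place of s v^2.  Either their multiples
   y w^2 a/q are equidistributed at the relevant scale, and the bound on V^3 W^2 suffices, or
   every relevant y is a multiple of one integer y0.  In the second case put
   g = gcd (y0, v^2) and let e be the least integer with g | e^2; then e | v, and y0 / g divides s.
   The v with e large are few.  For each of the remaining g, Cauchy-Schwarz over s reduces the
   count of w to that of s g (w - w') (w + w') close to 0 modulo q after multiplication by a,
   and the bound on V W^3 (used only as a bound on W) suffices.  If W is too small for the
   diagonal of that step, then 0 < s g w^2 < q because rho < 2/11, and no w occurs at all. *)

(** * Divisors *)

(** Since [q^2] is about [N^(2 + rho - eps/2)] and [L = N^(rho - eps/3)], the hypotheses become
    inequalities between [L], [V], [W], [q] and [N]. The bound on [V^3 W^2] gives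
    [L^4 V^3 W^2 << q^2]; the bound on [V W^3], with [V >= 1], gives [L^3 W << q]; [rho < 2/11]
    gives [L^6 << q]; the bound on [VW], with [rho > 1/6], gives [L^2 V W << N]. Finally
    [q^2 << L N^2] turns the distance scale [1 / (L X^2)] of Weyl's inequality into [M^2 / q^2]. The
    multiples of [eps] in these exponents leave room for every power of [om], and [om] pays for all
    divisor functions, logarithms and implied constants. The obstacle is that the [v^2] are sparse.
    Enlarging [s v^2] to all integers [y] is affordable only while the multiples of [w^2 a / q] are
    equidistributed. When the solutions concentrate on the multiples of [y0], the fact that [v^2] is
    a square has to be used: [g | v^2] confines [v] to the multiples of an [e] with [g <= e^2], and
    the density [1 / e] so gained offsets the loss of the factor [g] in the distance. *)

Lemma leq_exp_base k m n : (m <= n -> m ^ k <= n ^ k)%N.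
Proof. by case: k => // k mn; rewrite leq_exp2r. Qed.

Lemma size_divisors_pfactor p a m : prime p -> coprime p m -> (0 < m)%N ->
  (size (divisors (p ^ a * m)) <= a.+1 * size (divisors m))%N.
Proof.
move=> pp cpm m0.
have n0 : (0 < p ^ a * m)%N by rewrite muln_gt0 expn_gt0 prime_gt0.
pose s := [seq (p ^ i * d)%N | i <- iota 0 a.+1, d <- divisors m].
have -> : (a.+1 * size (divisors m))%N = size s by rewrite size_allpairs size_iota.
apply: uniq_leq_size; first exact: divisors_uniq.
move=> d; rewrite -dvdn_divisors // => dn.
have d0 : (0 < d)%N by apply: dvdn_gt0 dn.
have [d' cpd' dE] := pfactor_coprime pp d0.
set i := logn p d in dE.
have pid : (p ^ i %| p ^ a * m)%N by apply: dvdn_trans dn; rewrite dE dvdn_mull.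
have d'd : (d' %| p ^ a * m)%N by apply: dvdn_trans dn; rewrite dE dvdn_mulr.
apply/allpairsP; exists (i, d'); split.
- rewrite mem_iota add0n ltnS /=.
  by rewrite Gauss_dvdl ?coprimeXl // dvdn_Pexp2l ?prime_gt1 in pid.
- rewrite -dvdn_divisors //.
  by rewrite Gauss_dvdr ?coprimeXr // coprime_sym in d'd.
- by rewrite dE mulnC.
Qed.

(** From [a.+1 <= k * (a %/ k).+1 <= k * 2 ^ (a %/ k)]. This is the cost of a small prime in the
    divisor bound. *)
Lemma succ_exp_bound k a : (0 < k)%N -> (a.+1 ^ k <= k ^ k * 2 ^ a)%N.
Proof.
move=> k0; have le1 : (a.+1 <= k * 2 ^ (a %/ k))%N.
  apply: (@leq_trans (k * (a %/ k).+1)); last by rewrite leq_mul2l ltn_expl // orbT.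
  by rewrite mulnS {1}(divn_eq a k) addnC mulnC -addSn leq_add2r ltn_pmod.
apply: leq_trans (leq_exp_base k le1) _; rewrite expnMn leq_mul2l.
by rewrite -expnM leq_exp2l // leq_divM orbT.
Qed.

Lemma size_divisors_exp_pfactor k p m a c d : prime p -> coprime p m -> (0 < m)%N ->
  (a.+1 ^ k <= c * p ^ a)%N -> (size (divisors m) ^ k <= m * d)%N ->
  (size (divisors (p ^ a * m)) ^ k <= p ^ a * m * (c * d))%N.
Proof.
move=> pp cpm m0 ha hm.
apply: leq_trans (leq_exp_base k (size_divisors_pfactor a pp cpm m0)) _.
rewrite expnMn; apply: leq_trans (leq_mul ha hm) _.
by apply/eq_leq; lia.
Qed.

(** The bound d(n) << n^(1/k), raised to the power [k] to stay among integers. A prime power [p ^ a]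
    contributes [a.+1 ^ k / p ^ a], which can exceed 1 only for [p < 2 ^ k], because
    [a.+1 <= 2 ^ a]. *)
Lemma size_divisors_exp_le k n : (0 < k)%N -> (0 < n)%N ->
  (size (divisors n) ^ k <= n * (k ^ k) ^ (2 ^ k))%N.
Proof.
move=> k0.
have kk0 : (0 < k ^ k)%N by rewrite expn_gt0 k0.
suff H j m : (j <= 2 ^ k)%N -> (0 < m)%N ->
    (forall p, prime p -> p %| m -> (p < j) || (2 ^ k <= p))%N ->
    (size (divisors m) ^ k <= m * (k ^ k) ^ j)%N.
  by move=> n0; apply: H => // p _ _; case: ltnP.
(* Induction on [j]: each prime below [2 ^ k] costs a factor [k ^ k], larger primes cost none. *)
elim: j m => [|j IH] m.
  rewrite expn0 muln1 => _; elim/ltn_ind: m => m IHm m0 hm.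
  have [m1|m1] := leqP m 1.
    have -> : m = 1%N by apply/eqP; rewrite eqn_leq m1.
    by rewrite /= exp1n.
  have pp := pdiv_prime m1; have pm := pdiv_dvd m; set p := pdiv m in pp pm.
  have [m' cpm' mE] := pfactor_coprime pp m0; set a := logn p m in mE.
  have a0 : (0 < a)%N by rewrite logn_gt0 mem_primes pp m0.
  have m'0 : (0 < m')%N by move: m0; rewrite mE muln_gt0 => /andP[].
  have bp : (2 ^ k <= p)%N by have := hm _ pp pm; rewrite ltn0.
  rewrite mE mulnC -[X in (_ <= X)%N]muln1 -[1%N in X in (_ <= X)%N](muln1 1).
  apply: size_divisors_exp_pfactor => //.
    rewrite mul1n; apply: leq_trans (leq_exp_base k (ltn_expl a (ltnSn 1))) _.
    by rewrite expnAC leq_exp_base.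
  rewrite muln1; apply: IHm => //.
    by rewrite mE -[X in (X < _)%N]muln1 ltn_pmul2l // -[1%N](expn0 p) ltn_exp2l ?prime_gt1.
  by move=> r pr rm; apply: hm => //; rewrite mE dvdn_mulr.
move=> jk m0 hm.
have [/andP[pj jm]|njm] := boolP (prime j && (j %| m)); last first.
  apply: leq_trans (IH _ (ltnW jk) m0 _) _; last by rewrite leq_mul2l leq_pexp2l ?orbT.
  move=> p pp pm; have := hm _ pp pm; rewrite ltnS leq_eqVlt -orbA => /orP[/eqP pj|//].
  by move: njm; rewrite -pj pp pm.
have [m' cpm' mE] := pfactor_coprime pj m0; set a := logn j m in mE.
have m'0 : (0 < m')%N by move: m0; rewrite mE muln_gt0 => /andP[].
rewrite mE mulnC expnS; apply: size_divisors_exp_pfactor => //.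
  by apply: leq_trans (succ_exp_bound _ k0) _; rewrite leq_mul2l leq_exp_base ?prime_gt1 ?orbT.
apply: IH => //; first exact: ltnW.
move=> p pp pm; have := hm _ pp; rewrite mE dvdn_mulr // => /(_ isT).
rewrite ltnS leq_eqVlt -orbA => /orP[/eqP pE|//].
by move: cpm'; rewrite prime_coprime // -pE pm.
Qed.

(** * Least integer whose square is a multiple of a given integer *)

Lemma sqr_cover_ex (g : nat) : exists e, (0 < g)%N ==> (0 < e)%N && (g %| e ^ 2)%N.
Proof. by exists g; apply/implyP => ->; rewrite dvdn_exp. Qed.

(** If [g] is the product of prime powers [p ^ a], this is the product of the [p ^ ceil(a / 2)]. The
    guard in [sqr_cover_ex] makes the function total, with value 0 at [g = 0]. *)
Definition sqr_cover g := ex_minn (sqr_cover_ex g).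

Lemma sqr_cover_gt0 g : (0 < g)%N -> (0 < sqr_cover g)%N.
Proof. by rewrite /sqr_cover; case: ex_minnP => e /implyP h _ /h /andP[]. Qed.

Lemma dvdn_sqr_cover g : (0 < g)%N -> (g %| sqr_cover g ^ 2)%N.
Proof. by rewrite /sqr_cover; case: ex_minnP => e /implyP h _ /h /andP[]. Qed.

Lemma gcdn_sqr a b : (gcdn a b ^ 2 = gcdn (a ^ 2) (b ^ 2))%N.
Proof.
have [->|a0] := posnP a; first by rewrite gcd0n exp0n // gcd0n.
have d0 : (0 < gcdn a b)%N by rewrite gcdn_gt0 a0.
have /dvdnP[a' aE] := dvdn_gcdl a b; have /dvdnP[b' bE] := dvdn_gcdr a b.
have cab : coprime a' b'.
  by rewrite /coprime -(eqn_pmul2r d0) muln_gcdl -aE -bE mul1n.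
have c2 : gcdn (a' ^ 2) (b' ^ 2) = 1%N.
  by apply/eqP; rewrite -/(coprime _ _) coprimeXl ?coprimeXr.
set d := gcdn a b in d0 aE bE *.
by rewrite aE bE !expnMn -muln_gcdl c2 mul1n.
Qed.

Lemma sqr_cover_dvd g v : (0 < g)%N -> (0 < v)%N -> (g %| v ^ 2)%N -> (sqr_cover g %| v)%N.
Proof.
move=> g0 v0 gv; have e0 := sqr_cover_gt0 g0; have ge := dvdn_sqr_cover g0.
move: e0 ge; rewrite /sqr_cover; case: ex_minnP => e _ hmin e0 ge.
have d0 : (0 < gcdn e v)%N by rewrite gcdn_gt0 e0.
(* [g] also divides the square of [gcdn e v], so minimality of [e] gives [gcdn e v = e]. *)
have := hmin (gcdn e v); rewrite g0 d0 gcdn_sqr dvdn_gcd ge gv => /(_ isT) h.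
suff <- : gcdn e v = e by exact: dvdn_gcdr.
by apply/eqP; rewrite eqn_leq h dvdn_leq ?dvdn_gcdl.
Qed.

Local Open Scope ring_scope.

(** * Distance to the nearest integer *)

Lemma card_le_size (T : finType) (T' : eqType) (A : pred T) (f : T -> T') (s : seq T') :
  {in A &, injective f} -> (forall x, A x -> f x \in s) -> (#|A| <= size s)%N.
Proof.
move=> finj fs; rewrite cardE -(size_map f); apply: uniq_leq_size.
  by rewrite map_inj_in_uniq ?enum_uniq // => x y; rewrite !mem_enum; exact: finj.
by move=> y /mapP[x]; rewrite mem_enum => Ax ->; exact: fs.
Qed.

(** The change of variables used throughout: [phi] merges several variables into one, and [D] bounds
    the multiplicity, which is 1, a number of blocks of residues, or a divisor count. *)
Lemma sum_fiber (R : numDomainType) (T : finType) (A : pred T) (phi : T -> nat)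
    (n D : nat) (B : pred nat) (F : nat -> R) :
  (forall k, (k < n)%N -> B k -> 0 <= F k) ->
  (forall x, A x -> (phi x < n)%N && B (phi x)) ->
  (forall k, (k < n)%N -> B k -> (#|[pred x | A x & phi x == k]| <= D)%N) ->
  \sum_(x | A x) F (phi x) <= D%:R * \sum_(k < n | B k) F k.
Proof.
move=> F0 hphi hD.
have -> : \sum_(x | A x) F (phi x) =
    \sum_(x | A x) \sum_(k < n | B k && (phi x == k)) F k.
  apply: eq_bigr => x /hphi /andP[ltn Bx].
  rewrite (big_pred1 (Ordinal ltn)) // => k /=.
  by apply/andP/eqP => [[_ /eqP h]|->]; [exact: val_inj|rewrite /= eqxx Bx].
rewrite (exchange_big_dep (fun k : 'I_n => B k)) /=; last by move=> x k _ /andP[].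
rewrite mulr_sumr; apply: ler_sum => k Bk.
rewrite (eq_bigl (mem [pred x | A x & phi x == k])); last first.
  by move=> x; rewrite /= inE Bk.
rewrite sumr_const -[X in X <= _]mulr_natl ler_wpM2r ?F0 // ler_nat; exact: hD.
Qed.

Section Dist.
Variable R : realType.
Implicit Types (x y : R) (b c : int).

Lemma floor_itv1 x : (Num.floor x)%:~R <= x < (Num.floor x)%:~R + 1.
Proof. by rewrite -(intrD _ _ 1) floor_itv. Qed.

Definition dist x : R := `|x - (Num.floor (x + 1 / 2))%:~R|.

Lemma dist_ge0 x : 0 <= dist x. Proof. exact: normr_ge0. Qed.

Lemma dist_le_half x : dist x <= 1 / 2.
Proof.
have /andP[] := floor_itv1 (x + 1 / 2).
rewrite /dist ler_norml; set f := Num.floor _ => h1 h2; apply/andP; split; lra.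
Qed.

Lemma dist_le x b : dist x <= `|x - b%:~R|.
Proof.
have /andP[] := floor_itv1 (x + 1 / 2).
have := dist_le_half x; rewrite /dist; set f := Num.floor _ => hh h1 h2.
have [bf|fb|->//] := ltgtP b f.
  have : b%:~R + 1 <= f%:~R :> R by rewrite -(intrD _ b 1) ler_int lezD1.
  move=> h; rewrite (le_trans hh) // ler_normr; apply/orP; left; lra.
have : f%:~R + 1 <= b%:~R :> R by rewrite -(intrD _ f 1) ler_int lezD1.
move=> h; rewrite (le_trans hh) // ler_normr; apply/orP; right; lra.
Qed.

Lemma distP x : exists b, dist x = `|x - b%:~R|.
Proof. by eexists. Qed.

Lemma dist_near x b : `|x - b%:~R| <= 1 / 2 -> dist x = `|x - b%:~R|.
Proof.
move=> h; apply: le_anti; rewrite dist_le /=.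
have [c ->] := distP x.
have [bc|cb|->//] := ltgtP b c.
  have : b%:~R + 1 <= c%:~R :> R by rewrite -(intrD _ b 1) ler_int lezD1.
  move: h; rewrite ler_norml => /andP[h1 h2] h3.
  by rewrite (@le_trans _ _ (1/2)) ?ler_norml ?ler_normr //; lra.
have : c%:~R + 1 <= b%:~R :> R by rewrite -(intrD _ c 1) ler_int lezD1.
move: h; rewrite ler_norml => /andP[h1 h2] h3.
by rewrite (@le_trans _ _ (1/2)) ?ler_norml ?ler_normr //; lra.
Qed.

Lemma distB x y : dist (x - y) <= dist x + dist y.
Proof.
have [b ->] := distP x; have [c ->] := distP y.
apply: le_trans (dist_le _ (b - c)) _.
have -> : x - y - (b - c)%:~R = (x - b%:~R) - (y - c%:~R) by rewrite intrB; ring.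
exact: ler_normB.
Qed.

(* This is min (X, 1 / dist x); passing through [X^-1] gives the intended value [X] at
   [dist x = 0], where [1 / dist x] would be the junk value 0. *)
Definition rmin (X x : R) : R := (Num.max X^-1 (dist x))^-1.

Lemma rmin_ge0 X x : 0 < X -> 0 <= rmin X x.
Proof. by move=> X0; rewrite invr_ge0 le_max invr_ge0 ltW. Qed.

Lemma rmin_leX X x : 0 < X -> rmin X x <= X.
Proof.
move=> X0; rewrite -[leRHS]invrK lef_pV2 ?posrE ?lt_max ?invr_gt0 ?X0 //.
by rewrite le_max lexx.
Qed.

Lemma rmin_leV X x y : 0 < X -> 0 < y -> y <= dist x -> rmin X x <= y^-1.
Proof.
move=> X0 y0 yd; rewrite lef_pV2 ?posrE ?lt_max ?invr_gt0 ?X0 //.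
by rewrite le_max yd orbT.
Qed.

Lemma le_rmin X x z : 0 < X -> z <= X -> z * dist x <= 1 -> z <= rmin X x.
Proof.
move=> X0 zX zd; have m0 : 0 < Num.max X^-1 (dist x) by rewrite lt_max invr_gt0 X0.
rewrite -(ler_pM2r m0) mulVf ?gt_eqF //; rewrite /Num.max; case: ifP => _ //.
by rewrite ler_pdivrMr // mul1r.
Qed.

(** * Harmonic sums, Dirichlet approximation and residues *)

Definition harm (n : nat) : R := \sum_(1 <= i < n.+1) i%:R^-1.

Lemma harm_le m n : (m <= n)%N -> harm m <= harm n.
Proof.
move=> mn; rewrite /harm [leRHS](big_cat_nat (n := m.+1)) //= lerDl.
by rewrite sumr_ge0 // => i _; rewrite invr_ge0.
Qed.

Lemma harm_ge1 n : (0 < n)%N -> 1 <= harm n.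
Proof. by move=> n0; rewrite -[leLHS](_ : harm 1 = _) ?harm_le // /harm big_nat1 invr1. Qed.

Lemma dirichlet x (Q : nat) : (0 < Q)%N -> exists (s : nat) (b : int),
  [/\ (0 < s <= Q)%N, coprimez b s & `|s%:R * x - b%:~R| * Q%:R < 1].
Proof.
move=> Q0; pose fr k : R := k%:R * x - (Num.floor (k%:R * x))%:~R.
have fr01 k : 0 <= fr k < 1.
  by have /andP[h1 h2] := floor_itv1 (k%:R * x); rewrite /fr; apply/andP; split; lra.
have QR : 0 < Q%:R :> R by rewrite ltr0n.
have cell k : (Num.truncn (Q%:R * fr k) < Q)%N.
  have /andP[f0 f1] := fr01 k.
  by rewrite truncn_lt_nat ?mulr_ge0 // -[ltRHS]mulr1 ltr_pM2l.
pose f (k : 'I_Q.+1) : 'I_Q := Ordinal (cell k).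
have /injectivePn[i [j nij fij]] : ~~ injectiveb f.
  apply/negP => /injectiveP /leq_card; by rewrite !card_ord ltnn.
wlog ij : i j nij fij / (i < j)%N.
  move=> W; have [lij|lji|eij] := ltngtP i j; first exact: (W i j).
    by apply: (W j i) => //; rewrite eq_sym.
  by move: nij; rewrite -val_eqE /= eij eqxx.
pose s := (j - i)%N; pose b := Num.floor (j%:R * x) - Num.floor (i%:R * x).
have s0 : (0 < s)%N by rewrite subn_gt0.
have sQ : (s <= Q)%N by rewrite (leq_trans (leq_subr _ _)) // -ltnS.
have sb : `|s%:R * x - b%:~R| * Q%:R < 1.
  have -> : s%:R * x - b%:~R = fr j - fr i.
    rewrite /s /b /fr (natrB _ (ltnW ij)) intrB.
    move: (Num.floor (j%:R * x))%:~R (Num.floor (i%:R * x))%:~R => u v.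
    by rewrite mulrBl opprB !addrA; lra.
  have [/andP[i0 i1] /andP[j0 j1]] := (fr01 i, fr01 j).
  have /andP[ti1 ti2] := truncn_itv (mulr_ge0 (ltW QR) i0).
  have /andP[tj1 tj2] := truncn_itv (mulr_ge0 (ltW QR) j0).
  have e : Num.truncn (Q%:R * fr i) = Num.truncn (Q%:R * fr j) by have := congr1 val fij.
  rewrite -[X in _ * X](gtr0_norm QR) -normrM ltr_norml.
  rewrite -!natr1 e in ti1 ti2 tj1 tj2; apply/andP; split; lra.
(* The pigeonhole gives [s] and [b] that may share a factor; dividing it out only shrinks both the
   denominator and the error. *)
have g0 : (0 < gcdn `|b| s)%N by rewrite gcdn_gt0 s0 orbT.
set g := gcdn `|b| s in g0.
have /dvdnP[s' sE] : (g %| s)%N := dvdn_gcdr _ _.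
have /dvdzP[b' bE] : (g %| b)%Z by rewrite dvdzE /= dvdn_gcdl.
have s'0 : (0 < s')%N by move: s0; rewrite sE muln_gt0 => /andP[].
exists s', b'; split.
- by rewrite s'0 (leq_trans _ sQ) // sE leq_pmulr.
- rewrite /coprimez /gcdz /=; apply/eqP; congr Posz; apply/eqP.
  have gE : gcdn `|b| s = g by [].
  by rewrite -(eqn_pmul2r g0) muln_gcdl mul1n -sE -[X in gcdn (_ * X)]/(`|g%:Z|%N) -abszM -bE gE.
- apply: le_lt_trans sb; rewrite ler_wpM2r //.
  have -> : s%:R * x - b%:~R = (s'%:R * x - b'%:~R) * g%:R.
    by rewrite sE bE natrM intrM; ring.
  by rewrite normrM normr_nat ler_peMr // ler1n.
Qed.

(** Splitting off the integer part [c] makes the numerator a natural number, so that the residues of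
    [k * b] modulo [s] are computed in [nat]. *)
Lemma dirichlet_nat x (Q : nat) : (0 < Q)%N -> exists (s b : nat) (c : int),
  [/\ (0 < s <= Q)%N, coprime b s & `|s%:R * (x - c%:~R) - b%:R| * Q%:R < 1].
Proof.
move=> /(dirichlet x)[s [b [s0 cbs h]]]; case/andP: (s0) => sp _.
have sn0 : s%:Z != 0 by rewrite eqz_nat -lt0n.
exists s, `|(b %% s)%Z|%N, (b %/ s)%Z; split => //.
  have : coprimez (b %% s)%Z s by rewrite /coprimez gcdz_modl.
  by rewrite coprimezE.
have -> : (`|(b %% s)%Z|%N)%:R = (b %% s)%Z%:~R :> R.
  by rewrite -[in RHS](@gez0_abs (b %% s)%Z) ?modz_ge0.
have -> : s%:R * (x - (b %/ s)%Z%:~R) - (b %% s)%Z%:~R = s%:R * x - b%:~R.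
  have -> : b%:~R = (b %/ s)%Z%:~R * s%:R + (b %% s)%Z%:~R :> R.
    by rewrite {1}(divz_eq b s) rmorphD rmorphM.
  move: (b %/ s)%Z%:~R (b %% s)%Z%:~R => u v; ring.
exact: h.
Qed.

(** For [u < s], the distance from [u] to the nearest multiple of [s]. *)
Definition absmod (s u : nat) := minn u (s - u).

Lemma absmod_le_norm (s n : nat) (z : int) : (0 < s)%N ->
  (absmod s (n %% s))%:Z <= `|n%:Z + s%:Z * z|.
Proof.
move=> s0; have e := divn_eq n s; have l := ltn_pmod n s0; rewrite /absmod.
set u := (n %% s)%N in e l *; set k := (n %/ s)%N in e.
have -> : n%:Z + s%:Z * z = u%:Z + s%:Z * (z + k%:Z) by rewrite e; lia.
move: (z + k%:Z) => y.
have [y0|y0] : (0 <= y) \/ (y <= -1) by lia.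
  have : 0 <= s%:Z * y by rewrite mulr_ge0.
  lia.
have : s%:Z * y <= - s%:Z by rewrite -[leRHS]mulrN1 ler_wpM2l.
lia.
Qed.

(** Up to an integer, [k x] equals [k b / s] plus an error of size [k / s] times the approximation
    error. Multiplied by [s], the main part is at distance [absmod] from the multiples of [s]. *)
Lemma dist_residue x (s b k : nat) (c : int) : (0 < s)%N ->
  (absmod s ((k * b) %% s))%:R - k%:R * `|s%:R * (x - c%:~R) - b%:R|
    <= s%:R * dist (k%:R * x).
Proof.
move=> s0; have [f ->] := distP (k%:R * x).
set e := s%:R * (x - c%:~R) - b%:R.
have -> : s%:R * `|k%:R * x - f%:~R| =
    `|k%:R * e + ((k * b)%:Z + s%:Z * (k%:Z * c - f))%:~R|.
  rewrite -[X in X * `|_|]normr_nat -normrM; congr `|_|.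
  have -> : ((k * b)%:Z + s%:Z * (k%:Z * c - f))%:~R =
      k%:R * b%:R + s%:R * (k%:R * c%:~R - f%:~R) :> R.
    by rewrite PoszM rmorphD /= !rmorphM rmorphB rmorphM.
  by rewrite /e; move: c%:~R f%:~R => u v; ring.
have h := absmod_le_norm (k * b) (k%:Z * c - f) s0.
have : (absmod s ((k * b) %% s))%:R <=
    `|((k * b)%:Z + s%:Z * (k%:Z * c - f))%:~R| :> R.
  by rewrite -(ler_int R) intr_norm in h.
set A := _%:~R; move=> hA.
have := ler_normD (k%:R * e + A) (- (k%:R * e)).
rewrite addrAC subrr add0r normrN normrM normr_nat; lra.
Qed.

(** As [b] is invertible modulo [s], each block of [s] consecutive [k] meets every residue once. The
    quotient [k %/ s] numbers the blocks, the last of which may be incomplete. *)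
Lemma sum_residues (s b n : nat) (F : nat -> R) : (0 < s)%N -> coprime b s ->
  (forall u, 0 <= F u) ->
  \sum_(k < n) F ((k * b) %% s)%N <= (n %/ s).+1%:R * \sum_(u < s) F u.
Proof.
move=> s0 cbs F0.
apply: (@sum_fiber R _ predT (fun k : 'I_n => ((k * b) %% s)%N) s _ predT F) => //.
  by move=> x _; rewrite ltn_pmod.
move=> u us _; rewrite -[X in (_ <= X)%N](size_iota 0).
apply: (card_le_size (f := fun k : 'I_n => (k %/ s)%N)).
  move=> x y; rewrite !inE => /eqP hx /eqP hy hd; apply: val_inj => /=.
  rewrite (divn_eq x s) (divn_eq y s) hd; congr (_ + _)%N.
  apply/eqP; rewrite -/(_ == _ %[mod s]).
  wlog xy : x y hx hy hd / (x <= y)%N.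
    by move=> W; have [xy|/ltnW xy] := leqP x y; [|rewrite eq_sym]; apply: W.
  rewrite eq_sym eqn_mod_dvd // -(Gauss_dvdl _ (_ : coprime s b)) 1?coprime_sym //.
  by rewrite mulnBl -eqn_mod_dvd ?leq_mul2r ?xy ?orbT // hx hy.
by move=> x _; rewrite mem_iota add0n ltnS leq_div2r // ltnW.
Qed.

Lemma count_absmod (s : nat) (r : R) : 0 <= r ->
  \sum_(u < s) ((absmod s u)%:R <= r)%R%:R <= 2 * r + 1.
Proof.
move=> r0; have /andP[t1 t2] := truncn_itv r0; set t := Num.truncn r in t1 t2.
have -> : \sum_(u < s) ((absmod s u)%:R <= r)%R%:R =
    #|[pred u : 'I_s | (absmod s u)%:R <= r]|%:R :> R.
  rewrite -sum1_card natr_sum [RHS]big_mkcond /=; apply: eq_bigr => u _.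
  by rewrite inE; case: (_ <= r).
apply: (@le_trans _ _ (2 * t + 1)%:R); last by rewrite natrD natrM lerD2r ler_pM2l.
rewrite ler_nat.
have -> : (2 * t + 1)%N = size (iota 0 t.+1 ++ [seq s - i | i <- iota 1 t])%N.
  by rewrite size_cat size_map !size_iota; lia.
apply: (card_le_size (f := @nat_of_ord s)); first by move=> x y _ _; exact: val_inj.
move=> u hu.
have {hu} : (absmod s u <= t)%N by rewrite truncn_ge_nat.
have us := ltn_ord u.
rewrite mem_cat mem_iota /absmod geq_min => /orP[h|h]; apply/orP; [left; lia|right].
by apply/mapP; exists (s - u)%N; rewrite ?mem_iota; lia.
Qed.

Lemma count_residues (s b n : nat) (r : R) : (0 < s)%N -> coprime b s -> 0 <= r ->
  \sum_(k < n) ((absmod s ((k * b) %% s))%:R <= r)%R%:R <= (n%:R / s%:R + 1) * (2 * r + 1).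
Proof.
move=> s0 cbs r0.
have := sum_residues n s0 cbs (F := fun u => ((absmod s u)%:R <= r)%R%:R) (fun _ => ler0n _ _).
move/le_trans; apply; apply: ler_pM => //.
- by apply: sumr_ge0 => u _.
- rewrite -natr1 lerD2r ler_pdivlMr ?ltr0n // -natrM ler_nat leq_divM //.
- exact: count_absmod.
Qed.
End Dist.

(** * Reciprocal sums and near-integer counts along a Dirichlet approximation *)

Section Recip.
Variable R : realType.
Implicit Types (x X : R) (c : int).

(** The error times [i] stays below 1/2, so the multiples of [s x] move away from the integers
    linearly, without wrapping around. *)
Lemma dist_mul x (s b i Q : nat) c : (0 < Q)%N -> (2 * i <= Q)%N ->
  `|s%:R * (x - c%:~R) - b%:R| * Q%:R < 1 ->
  dist (i%:R * (s%:R * x)) = i%:R * `|s%:R * (x - c%:~R) - b%:R|.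
Proof.
move=> Q0 iQ; set e := s%:R * _ - _ => h.
have E : i%:R * (s%:R * x) - (i%:Z * (s%:Z * c + b%:Z))%:~R = i%:R * e.
  rewrite !rmorphM rmorphD rmorphM /= /e; move: c%:~R => u.
  by rewrite -!pmulrn; ring.
rewrite (@dist_near _ _ (i%:Z * (s%:Z * c + b%:Z))) E normrM normr_nat //.
have : (2 * i)%:R <= Q%:R :> R by rewrite ler_nat.
rewrite natrM => h2; have e0 := normr_ge0 e.
have := ler_wpM2l e0 h2; lra.
Qed.

Lemma absmod_gt0 (s u : nat) : (u < s)%N -> (0 < u)%N -> (0 < absmod s u)%N.
Proof. by rewrite /absmod; lia. Qed.

Lemma absmodV_le (s u : nat) : (u < s)%N -> (0 < u)%N ->
  (absmod s u)%:R^-1 <= u%:R^-1 + (s - u)%:R^-1 :> R.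
Proof.
move=> us u0; rewrite /absmod /minn; case: ifP => _.
  by rewrite lerDl invr_ge0.
by rewrite lerDr invr_ge0.
Qed.

(** Replacing the minimum in [absmod] by both one-sided reciprocals gives two harmonic sums. The
    value 0 at [u = 0] is a placeholder: this residue comes from the multiples of [s], which
    [recip_sum] treats apart. *)
Lemma sum_absmodV (s : nat) (F := fun u : nat => if u == 0%N then 0 else
    2 * s%:R * (u%:R^-1 + (s - u)%:R^-1) : R) : (0 < s)%N ->
  \sum_(u < s) F u <= 4 * s%:R * harm R s.
Proof.
case: s @F => // s F _; rewrite -(big_mkord xpredT F) big_nat_recl //= add0r.
have -> : \sum_(0 <= i < s) F i.+1 =
    2 * s.+1%:R * (\sum_(0 <= i < s) i.+1%:R^-1 + \sum_(0 <= i < s) (s - i)%:R^-1).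
  by rewrite -big_split mulr_sumr; apply: eq_bigr => i _; rewrite /F /= subSS.
rewrite [X in _ + X]big_nat_rev /= add0n.
have -> : \sum_(0 <= i < s) (s - (s - i.+1))%:R^-1 = \sum_(0 <= i < s) i.+1%:R^-1 :> R.
  by apply: eq_big_nat => i /andP[_ si]; rewrite subKn.
have -> : \sum_(0 <= i < s) i.+1%:R^-1 = harm R s by rewrite /harm big_add1.
have := ler_wpM2l (ler0n R s.+1) (harm_le R (leqnSn s)); lra.
Qed.

(** The residue is nonzero, so [absmod] is at least 1, and the error [k * e <= 1 / 2] takes away at
    most half of it. *)
Lemma rmin_nonmultiple x X (s b k Q : nat) c : 0 < X -> (0 < s)%N -> coprime b s ->
  (2 * k <= Q)%N -> (0 < Q)%N -> ~~ (s %| k)%N ->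
  `|s%:R * (x - c%:~R) - b%:R| * Q%:R < 1 ->
  rmin X (k%:R * x) <= 2 * s%:R * (((k * b) %% s)%:R^-1 + (s - (k * b) %% s)%:R^-1).
Proof.
move=> X0 s0 cbs kQ Q0 nsk hE; have us := ltn_pmod (k * b) s0.
have u0 : (0 < (k * b) %% s)%N.
  by rewrite lt0n -/(dvdn _ _) Gauss_dvdl // coprime_sym.
have := dist_residue x b k c s0; set e := `|_ - b%:R| in hE *.
set u := ((k * b) %% s)%N in us u0 *.
have r0 := absmod_gt0 us u0; move=> hd.
have sR : 0 < s%:R :> R by rewrite ltr0n.
have ke : k%:R * e <= 1 / 2.
  have : (2 * k)%:R <= Q%:R :> R by rewrite ler_nat.
  by rewrite natrM => h2; have := ler_wpM2l (normr_ge0 _ : 0 <= e) h2; lra.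
have r1 : 1 <= (absmod s u)%:R :> R by rewrite ler1n.
have rd : (absmod s u)%:R / (2 * s%:R) <= dist (k%:R * x).
  by rewrite ler_pdivrMr ?mulr_gt0 //; lra.
apply: (le_trans (rmin_leV X0 _ rd)); first by rewrite divr_gt0 ?mulr_gt0 ?ltr0n.
by rewrite invfM invrK mulrC ler_wpM2l ?mulr_ge0 ?absmodV_le.
Qed.

(** Dirichlet's theorem with denominators up to [2 * K] keeps the error harmless for all [k <= K].
    The [k] not divisible by [s] give the first term, through the spacing of residues; the multiples
    of [s] give the second. With [K] of order [L X], the maximum is the [t] of the overview: both
    the size of [s] and the quality of the approximation are kept. *)
Lemma recip_sum x X (K : nat) : (0 < K)%N -> 0 < X -> exists s : nat, (0 < s)%N /\
  \sum_(1 <= k < K.+1) rmin X (k%:R * x) <=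
    16 * K%:R * harm R (2 * K)
    + harm R K * X * K%:R / Num.max s%:R (X * K%:R * dist (s%:R * x)).
Proof.
move=> K0 X0; have Q0 : (0 < 2 * K)%N by lia.
have [s [b [c [/andP[s0 sQ] cbs hE]]]] := dirichlet_nat x Q0.
exists s; split=> //; have sR : 0 < s%:R :> R by rewrite ltr0n.
have KR : 0 < K%:R :> R by rewrite ltr0n.
rewrite (bigID (fun k => s %| k)%N) /= addrC; apply: lerD.
  pose F u : R := if u == 0%N then 0 else 2 * s%:R * (u%:R^-1 + (s - u)%:R^-1).
  have F0 u : 0 <= F u.
    by rewrite /F; case: eqP => // _; rewrite !mulr_ge0 ?addr_ge0 ?invr_ge0.
  apply: (@le_trans _ _ (\sum_(k < K.+1) F ((k * b) %% s)%N)).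
    rewrite big_geq_mkord [leRHS](bigID (fun k : 'I_K.+1 => ~~ (s %| k)%N && (0 < k)%N)) /=.
    rewrite -[leLHS]addr0; apply: lerD; last exact: sumr_ge0.
    apply: ler_sum => k /andP[nsk k0]; rewrite /F ifF.
      apply: rmin_nonmultiple hE => //; have := ltn_ord k; lia.
    by rewrite -/(dvdn _ _) Gauss_dvdl 1?coprime_sym //; apply: negbTE.
  apply: (le_trans (sum_residues K.+1 s0 cbs F0)).
  apply: (@le_trans _ _ ((K.+1 %/ s).+1%:R * (4 * s%:R * harm R s))).
    by rewrite ler_wpM2l // sum_absmodV.
  have h1 : ((K.+1 %/ s).+1 * s)%:R <= (4 * K)%:R :> R.
    by rewrite ler_nat; have := leq_divM K.+1 s; lia.
  rewrite !natrM in h1.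
  have h2 := harm_le R sQ; have h3 := harm_ge1 R s0.
  have -> : (K.+1 %/ s).+1%:R * (4 * s%:R * harm R s) =
    4 * ((K.+1 %/ s).+1%:R * s%:R) * harm R s by ring.
  apply: (@le_trans _ _ (4 * (4 * K%:R) * harm R s)).
    by rewrite ler_wpM2r ?ler_wpM2l //; lra.
  have -> : 16 * K%:R * harm R (2 * K) = 4 * (4 * K%:R) * harm R (2 * K) by ring.
  by rewrite ler_wpM2l // !mulr_ge0.
pose G i := rmin X (i%:R * (s%:R * x)).
have G0 i : 0 <= G i by apply: rmin_ge0.
have step : \sum_(1 <= k < K.+1 | (s %| k)%N) rmin X (k%:R * x) <=
    \sum_(1 <= i < (K %/ s).+1) G i.
  rewrite !big_geq_mkord /=.
  rewrite (eq_bigr (fun k : 'I_K.+1 => G (k %/ s)%N)); last first.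
    by move=> k /andP[sk _]; rewrite /G mulrA -natrM divnK.
  rewrite -[leRHS]mul1r; apply: (@sum_fiber R _ _ (fun k : 'I_K.+1 => (k %/ s)%N)
    (K %/ s).+1 1 (fun i => 0 < i)%N G) => //.
    move=> k /andP[sk k0]; apply/andP; split; last by rewrite divn_gt0 // dvdn_leq.
    by rewrite ltnS leq_div2r // -ltnS.
  move=> i _ _; apply: (@card_le_size _ _ _ (@nat_of_ord _) [:: (i * s)%N]).
    by move=> k l _ _; exact: val_inj.
  by move=> k; rewrite /= !inE => /andP[/andP[sk _]] /eqP <-; rewrite divnK.
apply: (le_trans step).
have H1 := harm_ge1 R K0.
set d := dist (s%:R * x).
have d0 : 0 <= d := dist_ge0 _.
have dE : d = `|s%:R * (x - c%:~R) - b%:R|.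
  by have := dist_mul (i := 1) Q0 _ hE; rewrite !mul1r; apply; lia.
have KsR : (K %/ s)%:R <= K%:R / s%:R :> R.
  by rewrite ler_pdivlMr // -natrM ler_nat leq_divM.
(* If [X K d > s], the bounds [1 / (i d)] add up to a harmonic number; otherwise each of the at most
   [K / s] multiples is bounded by [X]. *)
rewrite /Num.max; case: ifP => [hs|_].
  have dp : 0 < d by rewrite -(pmulr_rgt0 d (mulr_gt0 X0 KR)) (lt_trans sR).
  have -> : harm R K * X * K%:R / (X * K%:R * d) = harm R K * d^-1.
    by field; rewrite !gt_eqF.
  apply: (@le_trans _ _ (\sum_(1 <= i < (K %/ s).+1) (i%:R^-1 * d^-1))).
    apply: ler_sum_nat => i /andP[i0 iK]; rewrite -invfM; apply: rmin_leV => //.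
      by rewrite mulr_gt0 ?ltr0n.
    rewrite (dist_mul Q0 _ hE) -?dE //.
    by rewrite leq_pmul2l // (leq_trans _ (leq_div K s)).
  rewrite -mulr_suml ler_wpM2r ?invr_ge0 //; apply: harm_le; exact: leq_div.
apply: (@le_trans _ _ (\sum_(1 <= i < (K %/ s).+1) X)).
  by apply: ler_sum => i _; apply: rmin_leX.
rewrite sumr_const_nat subn1 /= -[X in X <= _]mulr_natl.
apply: (@le_trans _ _ (K%:R / s%:R * X)); first by rewrite ler_wpM2r // ltW.
have -> : harm R K * X * K%:R / s%:R = harm R K * (K%:R / s%:R * X) by ring.
by rewrite ler_peMl // mulr_ge0 ?divr_ge0 // ltW.
Qed.

(** With a denominator [s <= 2 Y], everything depends on [s d]. If [2 s d >= 1], the residues fill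
    the window evenly and the count has its expected order [Y d]. If [2 s d < 1], the window and the
    error together leave room for the residue 0 only, so [s | y], and [dist_mul] applies. *)
Lemma near_int_dichotomy x (Y : nat) (d : R) : (0 < Y)%N -> 0 < d -> exists s : nat,
  [/\ (0 < s)%N, (s <= 2 * Y)%N &
   \sum_(1 <= y < Y.+1) (dist (y%:R * x) <= d)%R%:R <= 24 * Y%:R * d
   \/ forall y, (0 < y <= Y)%N -> dist (y%:R * x) <= d ->
        (s %| y)%N /\ (y %/ s)%:R * dist (s%:R * x) <= d].
Proof.
move=> Y0 d0; have Q0 : (0 < 2 * Y)%N by lia.
have [s [b [c [/andP[s0 sQ] cbs hE]]]] := dirichlet_nat x Q0.
have sR : 0 < s%:R :> R by rewrite ltr0n.
exists s; split=> //; set e := `|_ - b%:R| in hE.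
have e0 : 0 <= e by apply: normr_ge0.
have ye y : (y <= Y)%N -> y%:R * e <= 1 / 2.
  move=> yY; have : (2 * y)%:R <= (2 * Y)%:R :> R by rewrite ler_nat; lia.
  by rewrite natrM => h2; have := ler_wpM2l e0 h2; lra.
have [big|small] := lerP 1 (2 * s%:R * d); [left|right].
  (* The summand 1/2 absorbs the error [y * e]. *)
  pose r := s%:R * d + 1 / 2; have r0 : 0 <= r by rewrite /r; lra.
  apply: (@le_trans _ _ (\sum_(k < Y.+1) ((absmod s ((k * b) %% s))%:R <= r)%R%:R)).
    rewrite -(big_mkord xpredT (fun k => ((absmod s ((k * b) %% s))%:R <= r)%R%:R)).
    rewrite [leRHS]big_nat_recl // -[leLHS]add0r; apply: lerD => //.
    rewrite [leLHS]big_add1 /=; apply: ler_sum_nat => y0 /andP[_ yY].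
    move: y0.+1 yY => y yY.
    rewrite ler_nat; case: (lerP (dist _) d) => // hd.
    rewrite lt0b; have := dist_residue x b y c s0; rewrite -/e => h.
    have := ye _ yY; have := ler_wpM2l (ltW sR) hd; rewrite /r; lra.
  apply: (le_trans (count_residues Y.+1 s0 cbs r0)).
  have Y1 : 1 <= Y%:R :> R by rewrite ler1n.
  have h1 : Y.+1%:R / s%:R + 1 <= 4 * Y%:R / s%:R :> R.
    have : s%:R <= (2 * Y)%:R :> R by rewrite ler_nat.
    rewrite natrM => h; have eY : Y.+1%:R = Y%:R + 1 :> R by rewrite natr1.
    rewrite eY.
    have -> : (Y%:R + 1) / s%:R + 1 = (Y%:R + 1 + s%:R) / s%:R :> R by field; rewrite gt_eqF.
    by rewrite ler_pM2r ?invr_gt0 //; lra.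
  have h2 : 2 * r + 1 <= 6 * s%:R * d by rewrite /r; lra.
  apply: (@le_trans _ _ (4 * Y%:R / s%:R * (6 * s%:R * d))).
    by apply: ler_pM => //; lra.
  by rewrite le_eqVlt; apply/orP; left; apply/eqP; field; rewrite gt_eqF.
move=> y /andP[y0 yY] hd.
have sy : (s %| y)%N.
  apply: contraT => nsy; have us := ltn_pmod (y * b) s0.
  have u0 : (0 < (y * b) %% s)%N.
    by rewrite lt0n -/(dvdn _ _) Gauss_dvdl // coprime_sym.
  have r1 : 1 <= (absmod s ((y * b) %% s))%:R :> R by rewrite ler1n absmod_gt0.
  have := dist_residue x b y c s0; rewrite -/e => h.
  by have := ye _ yY; have := ler_wpM2l (ltW sR) hd; lra.
split=> //; move: hd; rewrite -{1}(divnK sy) natrM -mulrA.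
rewrite (dist_mul Q0 _ hE); last by have := leq_div y s; lia.
have := dist_mul (i := 1) Q0 _ hE; rewrite !mul1r => -> //; lia.
Qed.

(** At [a / q] itself the error term of [dist_residue] vanishes, so the residue count applies to
    every length [Z], beyond [q] as well. *)
Lemma count_near_frac (a : int) (q : nat) (Z : nat) (eta : R) :
  (0 < q)%N -> coprimez a q -> 0 <= eta ->
  \sum_(z < Z) (q%:R * dist (z%:R * (a%:~R / q%:R)) <= eta)%R%:R
    <= (Z%:R / q%:R + 1) * (2 * eta + 1) :> R.
Proof.
move=> q0 caq eta0; have qR : 0 < q%:R :> R by rewrite ltr0n.
have qz : q%:Z != 0 by rewrite eqz_nat -lt0n.
pose b := `|(a %% q)%Z|%N; pose c := (a %/ q)%Z.
have cbq : coprime b q.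
  have : coprimez (a %% q)%Z q by rewrite /coprimez gcdz_modl.
  by rewrite coprimezE.
have E : q%:R * (a%:~R / q%:R - c%:~R) - b%:R = 0 :> R.
  have -> : b%:R = (a %% q)%Z%:~R :> R.
    by rewrite -[in RHS](@gez0_abs (a %% q)%Z) ?modz_ge0.
  have -> : a%:~R = (a %/ q)%Z%:~R * q%:R + (a %% q)%Z%:~R :> R.
    by rewrite {1}(divz_eq a q) rmorphD rmorphM.
  rewrite /c; move: (a %/ q)%Z%:~R (a %% q)%Z%:~R => u v; field.
  by rewrite gt_eqF.
apply: le_trans (count_residues Z q0 cbq eta0); apply: ler_sum => z _.
rewrite ler_nat; case: (lerP (_ * dist _) eta) => // hd.
have := dist_residue (a%:~R / q%:R : R) b z c q0; rewrite E normr0 mulr0 subr0 => h.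
by rewrite lt0b (le_trans h).
Qed.

Lemma frac_far (a : int) (q z : nat) :
  (0 < z < q)%N -> coprimez a q -> 1 <= q%:R * dist (z%:R * (a%:~R / q%:R)) :> R.
Proof.
move=> /andP[z0 zq] caq; have q0 : (0 < q)%N by apply: leq_trans zq.
have [f ->] := distP (z%:R * (a%:~R / q%:R) : R).
rewrite -[X in X * _](normr_nat R) -normrM.
have -> : q%:R * (z%:R * (a%:~R / q%:R) - f%:~R) = (z%:Z * a - q%:Z * f)%:~R :> R.
  rewrite rmorphB !rmorphM /=; move: a%:~R f%:~R => u v; rewrite -!pmulrn; field.
  by rewrite pnatr_eq0 -lt0n.
rewrite -intr_norm -[leLHS]/(1%:~R) ler_int -gtz0_ge1 normr_gt0 subr_eq0.
apply: contraTneq zq => e; rewrite -leqNgt dvdn_leq //.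
have : (q %| z%:Z * a)%Z by rewrite e dvdz_mulr.
by rewrite Gauss_dvdzl 1?coprimez_sym.
Qed.
End Recip.

(** * Weyl differencing *)

Lemma sum_triangle (V : nmodType) (G : nat -> nat -> V) m :
  \sum_(0 <= j < m) \sum_(0 <= i < j) G j i =
  \sum_(1 <= h < m) \sum_(0 <= i < m - h) G (i + h)%N i.
Proof.
elim: m => [|m IH]; first by rewrite !big_geq.
rewrite big_nat_recr //= IH.
have [->|m0] := posnP m; first by rewrite !big_geq // addr0.
have -> : \sum_(1 <= h < m.+1) \sum_(0 <= i < m.+1 - h) G (i + h)%N i =
    \sum_(1 <= h < m.+1) (\sum_(0 <= i < m - h) G (i + h)%N i + G m (m - h)%N).
  by apply: eq_big_nat => h /andP[_ hm]; rewrite subSn // big_nat_recr //= subnK.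
rewrite big_split /=; congr (_ + _).
  by rewrite big_nat_recr //= subnn [X in _ = _ + X]big_geq // addr0.
rewrite big_add1 /= big_nat_rev /=; apply: eq_big_nat => i /andP[_ im].
by rewrite add0n.
Qed.

(** Applied to membership in a real interval, this turns each inner sum into one over consecutive
    integers. *)
Lemma convex_range (P : pred nat) T :
  (forall i j k, (i <= j <= k)%N -> P i -> P k -> P j) ->
  exists a b, [/\ (1 <= a)%N, (a <= b)%N, (b <= T.+1)%N &
    forall n, (1 <= n <= T)%N -> P n = (a <= n < b)%N].
Proof.
move=> cP; elim: T => [|T [a [b [a1 ab bT h]]]].
  by exists 1%N, 1%N; split => // n; lia.
have [PT|nPT] := boolP (P T.+1); last first.
  exists a, b; split=> //; first lia.
  move=> n /andP[n1]; rewrite leq_eqVlt => /orP[/eqP ->|nT]; last by apply: h; lia.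
  by rewrite (negbTE nPT); lia.
have [ba|lab] := leqP b a.
  exists T.+1, T.+2; split => // n /andP[n1]; rewrite leq_eqVlt => /orP[/eqP ->|nT].
    by rewrite PT; lia.
  by rewrite h; lia.
have Pa : P a by rewrite h; lia.
exists a, T.+2; split => //; first lia.
move=> n /andP[n1 nT]; have [an|na] := leqP a n.
  by rewrite (cP a n T.+1); lia.
by rewrite h; lia.
Qed.

(** * Additive character, geometric sums and Weyl's inequality *)

Section Expe.
Variable R : realType.
Implicit Types (x y A B c X : R) (z : R[i]).
Local Notation normc := (@Normc.normc R).
Local Notation expe := (@Defs.expe R).
Local Notation Re := (@complex.Re R).
Local Notation Im := (@complex.Im R).

Lemma expeD x y : expe (x + y) = expe x * expe y.
Proof.
rewrite /Defs.expe mulrDr cosD sinD; apply/eqP; rewrite eq_complex /=.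
by rewrite eqxx addrC mulrC [X in _ == X + _]mulrC [cos (_ * x) * _]mulrC eqxx.
Qed.

Lemma expe0 : expe (0 : R) = 1.
Proof. by rewrite /Defs.expe mulr0 cos0 sin0. Qed.

Lemma expe_muln x n : expe (x * n%:R) = expe x ^+ n.
Proof.
by elim: n => [|n IH]; rewrite ?mulr0 ?expe0 ?expr0 // -natr1 mulrDr mulr1 expeD IH exprSr.
Qed.

Lemma expe1 : expe (1 : R) = 1.
Proof.
rewrite /Defs.expe mulr1 (_ : 2 * pi = pi *+ 2) ?cos2pi ?sin2pi //; by rewrite mulr_natl.
Qed.

Lemma expe_nat n : expe (n%:R : R) = 1.
Proof. by rewrite -[n%:R]mul1r expe_muln expe1 expr1n. Qed.

Lemma expe_int (b : int) : expe (b%:~R : R) = 1.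
Proof.
case: b => n; first exact: expe_nat.
by have := expeD (- n.+1%:R) n.+1%:R; rewrite addNr expe0 expe_nat mulr1 NegzE mulrNz.
Qed.

Lemma normc_ge0 z : 0 <= normc z.
Proof. by case: z => a b; exact: sqrtr_ge0. Qed.

Lemma normc_sqr z : normc z ^+ 2 = Re z ^+ 2 + Im z ^+ 2.
Proof. by case: z => a b /=; rewrite sqr_sqrtr // addr_ge0 // sqr_ge0. Qed.

Lemma normc_expe x : normc (expe x) = 1.
Proof. by rewrite /= cos2Dsin2 sqrtr1. Qed.

Lemma le_normc_Re z : `|Re z| <= normc z.
Proof.
case: z => a b /=; rewrite -sqrtr_sqr ler_wsqrtr // lerDl sqr_ge0 //.
Qed.

Lemma le_normc_sum (I : Type) (r : seq I) (P : pred I) (F : I -> R[i]) :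
  normc (\sum_(i <- r | P i) F i) <= \sum_(i <- r | P i) normc (F i).
Proof.
elim/big_ind2: _ => [|u a v b ha hb|//]; first by rewrite Normc.normc0.
by apply: le_trans (le_normcD _ _) _; apply: lerD.
Qed.

Lemma one_sub_expe_ge y : 0 < y -> y <= 1 / 2 -> 2 * y <= normc (1 - expe y).
Proof.
(* For n about 1 / (2 y) the point n y lies in [1/4, 1/2], so 1 - e(n y) is not small;
   and it is at most n times 1 - e(y). *)
move=> y0 y12; pose n := Num.truncn (2 * y)^-1.
have y20 : 0 < 2 * y by lra.
have yV1 : 1 <= (2 * y)^-1 by rewrite -[leLHS]invr1 lef_pV2 ?posrE //; lra.
have /andP[n1 n2] := truncn_itv (le_trans ler01 yV1); rewrite -/n in n1 n2.
have n0 : (0 < n)%N by rewrite truncn_gt0.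
have e1 : n%:R * (2 * y) <= 1 by rewrite -ler_pdivlMr // mul1r.
have e2 : 1 < n.+1%:R * (2 * y) by rewrite -ltr_pdivrMr // mul1r.
have nR : 1 <= n%:R :> R by rewrite ler1n.
have e3 : 1 / 4 <= n%:R * y.
  have : y <= n%:R * y by rewrite ler_peMl // ltW.
  move: e2; rewrite -natr1; lra.
have cos_le : cos (2 * pi * (y * n%:R)) <= 0.
  have -> : 2 * pi * (y * n%:R) = (2 * pi * (y * n%:R) - pi / 2) + pi / 2 :> R by ring.
  rewrite cosDpihalf oppr_le0; apply: sin_ge0_pi.
  have p0 := pi_gt0 R; apply/andP; split.
    have := ler_wpM2l (ltW p0) e3; lra.
  have := ler_wpM2l (ltW p0) e1; lra.
have h1 : 1 <= normc (1 - expe (y * n%:R)).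
  apply: le_trans (le_normc_Re _); rewrite /= ger0_norm; lra.
have h2 : normc (1 - expe (y * n%:R)) <= normc (1 - expe y) * n%:R.
  have -> : 1 - expe (y * n%:R) = (1 - expe y) * \sum_(i < n) expe y ^+ i.
    by rewrite expe_muln -opprB subrX1 -mulNr opprB.
  rewrite Normc.normcM ler_wpM2l ?normc_ge0 //; apply: le_trans (le_normc_sum _ _ _) _.
  rewrite (eq_bigr (fun _ => 1)) ?sumr_const ?card_ord // => i _.
  by rewrite -expe_muln normc_expe.
rewrite -(ler_pM2r (lt_le_trans ltr01 nR)); lra.
Qed.

Lemma one_sub_expe_dist x : 2 * dist x <= normc (1 - expe x).
Proof.
have [b dE] := distP x; have dh := dist_le_half x.
have [->|d0] := eqVneq (dist x) 0; first by rewrite mulr0 normc_ge0.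
have dp : 0 < dist x by rewrite lt_def d0 dist_ge0.
apply: le_trans (one_sub_expe_ge dp dh) _.
have xE : expe x = expe (x - b%:~R) by rewrite expeD -mulrNz expe_int mulr1.
rewrite xE dE; case: (ger0P (x - b%:~R)) => _ //.
set u := x - _; have uE : 1 - expe (- u) = (-1) * (expe (- u) * (1 - expe u)).
  by rewrite mulN1r mulrBr mulr1 -expeD addNr expe0 [RHS]opprB.
by rewrite uE !Normc.normcM normcN Normc.normc1 normc_expe !mul1r.
Qed.

(** Telescoping against [1 - expe x]. The product form remains meaningful at [dist x = 0] and is
    what [le_rmin] takes. *)
Lemma geometric_expe x c (a b : nat) : (a <= b)%N ->
  normc (\sum_(a <= n < b) expe (x * n%:R + c)) * dist x <= 1.
Proof.
move=> ab; have tel : (\sum_(a <= n < b) expe (x * n%:R + c)) * (1 - expe x) =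
    expe c * (expe x ^+ a - expe x ^+ b).
  have := telescope_sumr (fun n => - (expe x ^+ n)) ab; rewrite /= opprK addrC => <-.
  rewrite mulr_suml mulr_sumr; apply: eq_bigr => n _.
  by rewrite expeD expe_muln exprSr opprK; ring.
have := congr1 normc tel; rewrite !Normc.normcM normc_expe mul1r => e.
have h : normc (expe x ^+ a - expe x ^+ b) <= 2.
  apply: le_trans (le_normcD _ _) _; rewrite normcN -!expe_muln !normc_expe; lra.
have := ler_wpM2l (normc_ge0 (\sum_(a <= n < b) expe (x * n%:R + c))) (one_sub_expe_dist x).
rewrite e => h2; lra.
Qed.

Lemma normc_sum_sqr (f : nat -> R) m :
  normc (\sum_(0 <= i < m) expe (f i)) ^+ 2 =
  m%:R + 2 * Re (\sum_(0 <= j < m) \sum_(0 <= i < j) expe (f j - f i)).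
Proof.
elim: m => [|m IH]; first by rewrite !big_geq // Normc.normc0 expr0n /= mulr0 addr0.
rewrite !big_nat_recr //=.
have -> : \sum_(0 <= i < m) expe (f m - f i) =
    expe (f m) * conjc (\sum_(0 <= i < m) expe (f i)).
  rewrite rmorph_sum mulr_sumr; apply: eq_bigr => i _ /=.
  by rewrite expeD; congr (_ * _); rewrite /Defs.expe mulrN cosN sinN.
move: IH; rewrite !normc_sqr !raddfD /=.
move: (\sum_(0 <= i < m) _) (\sum_(0 <= j < m) _) => [u v] [u' v'] /= IH.
have e := cos2Dsin2 (2 * pi * f m); rewrite -natr1.
move: (cos _) (sin _) e => C S e; move: IH => IH.
nra.
Qed.

(** Grouping the pairs by their difference [h] makes the phase linear with slope [2 A h]; [B] and
    [c] survive only in a constant phase. The cut-off [H] frees the range of [h] from the particular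
    interval. *)
Lemma weyl_differencing A B c X (a b H : nat) : (a <= b)%N -> 0 < X ->
  (b - a)%:R <= X -> (b - a <= H)%N ->
  normc (\sum_(a <= n < b) expe (A * n%:R ^+ 2 + B * n%:R + c)) ^+ 2
    <= X + 2 * \sum_(1 <= h < H.+1) rmin X (h%:R * (2 * A)).
Proof.
move=> ab X0 mX mH; set m := (b - a)%N in mX mH.
pose f (n : nat) := A * (n + a)%:R ^+ 2 + B * (n + a)%:R + c.
have -> : \sum_(a <= n < b) expe (A * n%:R ^+ 2 + B * n%:R + c) =
    \sum_(0 <= n < m) expe (f n).
  by rewrite -{1}[a]add0n big_addn.
rewrite normc_sum_sqr sum_triangle; apply: lerD => //; rewrite ler_pM2l //.
apply: le_trans (ler_norm _) _; apply: le_trans (le_normc_Re _) _.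
apply: le_trans (le_normc_sum _ _ _) _.
apply: (@le_trans _ _ (\sum_(1 <= h < m.+1) rmin X (h%:R * (2 * A)))); last first.
  rewrite [leRHS](big_cat_nat (n := m.+1)) //= lerDl.
  by rewrite sumr_ge0 // => i _; apply: rmin_ge0.
have [->|m0] := posnP m; first by rewrite !big_geq.
rewrite [leRHS]big_nat_recr //= -[leLHS]addr0; apply: lerD; last exact: rmin_ge0.
apply: ler_sum_nat => h /andP[h1 hm].
have -> : \sum_(0 <= i < m - h) expe (f (i + h)%N - f i) =
    \sum_(0 <= i < m - h) expe (h%:R * (2 * A) * i%:R +
      (A * (2 * a%:R * h%:R + h%:R ^+ 2) + B * h%:R)).
  by apply: eq_bigr => i _; congr expe; rewrite /f !natrD; ring.
apply: le_rmin => //; last exact: geometric_expe.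
apply: le_trans (le_normc_sum _ _ _) _.
rewrite (eq_bigr (fun _ => 1)) => [|i _]; last exact: normc_expe.
rewrite sumr_const_nat subn0; apply: le_trans mX; rewrite ler_nat; exact: leq_subr.
Qed.

(** Over all multiples of the phase, the frequencies [2 i h] merge into one variable [k]; as
    [i | k], each [k] arises at most d(k) times. *)
Lemma weyl_sum_multiples A B c X (a b l H K D : nat) : (a <= b)%N -> 0 < X ->
  (b - a)%:R <= X -> (b - a <= H)%N -> (2 * l * H <= K)%N ->
  (forall k, (0 < k <= K)%N -> (size (divisors k) <= D)%N) ->
  \sum_(1 <= i < l.+1)
    normc (\sum_(a <= n < b) expe (i%:R * (A * n%:R ^+ 2 + B * n%:R + c))) ^+ 2
  <= l%:R * X + 2 * D%:R * \sum_(1 <= k < K.+1) rmin X (k%:R * A).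
Proof.
move=> ab X0 mX mH lHK hD.
apply: (@le_trans _ _ (\sum_(1 <= i < l.+1)
   (X + 2 * \sum_(1 <= h < H.+1) rmin X ((2 * i * h)%:R * A)))).
  apply: ler_sum_nat => i _.
  have := weyl_differencing (i%:R * A) (i%:R * B) (i%:R * c) ab X0 mX mH.
  rewrite (eq_bigr (fun n : nat => expe (i%:R * (A * n%:R ^+ 2 + B * n%:R + c)))); last first.
    by move=> n _; congr expe; ring.
  move/le_trans; apply; rewrite lerD2l ler_pM2l //; apply: ler_sum => h _.
  by rewrite !natrM (_ : 2 * _ * _ * A = h%:R * (2 * (i%:R * A))) //; ring.
rewrite big_split /= sumr_const_nat subn1 /= mulr_natl lerD2l -mulr_sumr -mulrA.
rewrite ler_pM2l // !big_geq_mkord /=.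
under eq_bigr do rewrite big_geq_mkord /=.
rewrite pair_big_dep /=.
apply: (@sum_fiber R _ (fun p : 'I_l.+1 * 'I_H.+1 => (0 < p.1)%N && (0 < p.2)%N)
  (fun p => (2 * p.1 * p.2)%N) K.+1 D (fun k => (0 < k)%N)
  (fun k => rmin X (k%:R * A))).
- by move=> k _ _; apply: rmin_ge0.
- move=> [i h] /= /andP[i0 h0]; have il := ltn_ord i; have hH := ltn_ord h.
  rewrite !muln_gt0 i0 h0 /= ltnS andbT; apply: leq_trans lHK.
  by rewrite leq_mul // ?leq_mul2l // -ltnS.
- move=> k kK k0; apply: leq_trans (hD k _); last by rewrite k0.
  apply: (@card_le_size _ _ _ (fun p : 'I_l.+1 * 'I_H.+1 => nat_of_ord p.1)).
    move=> [i h] [i' h']; rewrite !inE /= => /andP[/andP[i0 h0] /eqP e].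
    move=> /andP[_ /eqP e'] ii'; have eii : i = i' by exact: val_inj.
    subst i'; congr pair; apply: val_inj => /=; apply/eqP.
    by rewrite -(eqn_pmul2l (_ : 0 < 2 * i)%N) ?muln_gt0 ?i0 // e e'.
  move=> [i h] /= /andP[_ /eqP e]; rewrite -dvdn_divisors // -e.
  by rewrite -mulnA dvdn_mull // dvdn_mulr.
Qed.
End Expe.

(** * Counting near coincidences *)

(** Cauchy-Schwarz against the constant 1, read off from the sum of squared deviations from the
    mean. *)
Lemma sqr_sum_le (R : realFieldType) (n : nat) (F : nat -> R) :
  (\sum_(1 <= i < n.+1) F i) ^+ 2 <= n%:R * \sum_(1 <= i < n.+1) F i ^+ 2.
Proof.
case: n => [|n]; first by rewrite !big_geq // mul0r expr0n.
set S := \sum_(_ <= _ < _) F _; set Q := \sum_(_ <= _ < _) _ ^+ 2.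
have n0 : 0 < n.+1%:R :> R by rewrite ltr0n.
have : 0 <= \sum_(1 <= i < n.+2) (F i - S / n.+1%:R) ^+ 2.
  by apply: sumr_ge0 => i _; rewrite sqr_ge0.
have -> : \sum_(1 <= i < n.+2) (F i - S / n.+1%:R) ^+ 2 = Q - S ^+ 2 / n.+1%:R.
  rewrite (eq_bigr (fun i => F i ^+ 2 + (- 2 * (S / n.+1%:R)) * F i + (S / n.+1%:R) ^+ 2)).
    rewrite !big_split /= -/Q -mulr_sumr -/S sumr_const_nat subn1 /= -[X in _ + X]mulr_natl.
    by field; rewrite gt_eqF.
  by move=> i _; ring.
by rewrite subr_ge0 ler_pdivrMr // mulrC.
Qed.

Lemma sqr_sum_triangle (R : comPzRingType) (n : nat) (F : nat -> R) :
  (\sum_(0 <= i < n) F i) ^+ 2 =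
  \sum_(0 <= i < n) F i ^+ 2 + (\sum_(0 <= j < n) \sum_(0 <= i < j) F j * F i) *+ 2.
Proof.
elim: n => [|n IH]; first by rewrite !big_geq // mul0rn addr0 expr0n.
rewrite !big_nat_recr //= sqrrD IH -mulr_sumr; ring.
Qed.

Section Count.
Variable R : realType.

Lemma count_multiples (e n : nat) : (0 < e)%N ->
  \sum_(0 <= v < n.+1 | (0 < v)%N) (e %| v)%N%:R <= n%:R / e%:R :> R.
Proof.
move=> e0; rewrite big_mkord.
apply: (@le_trans _ _ (\sum_(v < n.+1 | (0 < v)%N && (e %| v)%N) 1)).
  by rewrite [leRHS]big_mkcondr /=; apply: ler_sum => v _; case: (_ %| _)%N.
have := @sum_fiber R _ (fun v : 'I_n.+1 => (0 < v)%N && (e %| v)%N)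
  (fun v => (v %/ e)%N) (n %/ e).+1 1 (fun i => 0 < i)%N (fun=> 1).
move=> /(_ (fun _ _ _ => ler01)) h; apply: le_trans (h _ _) _.
- move=> v /andP[v0 ev]; apply/andP; split; last by rewrite divn_gt0 // dvdn_leq.
  by rewrite ltnS leq_div2r // -ltnS.
- move=> i _ _; apply: (@card_le_size _ _ _ (@nat_of_ord _) [:: (i * e)%N]).
    by move=> k l _ _; exact: val_inj.
  by move=> k; rewrite /= !inE => /andP[/andP[_ ek]] /eqP <-; rewrite divnK.
have -> : \sum_(k < (n %/ e).+1 | (0 < k)%N) 1 = \sum_(1 <= k < (n %/ e).+1) 1 :> R.
  by rewrite big_geq_mkord.
rewrite mul1r sumr_const_nat subn1 /=.
by rewrite ler_pdivlMr ?ltr0n // -natrM ler_nat leq_divM.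
Qed.

Lemma dyadic_gt0 (V : R) v : 0 <= V -> dyadic V v -> (0 < v)%N.
Proof. by move=> V0 /andP[h _]; rewrite -(ltr0n R) (le_lt_trans V0). Qed.

Lemma dyadic_multiples (V : R) (e : nat) : 0 <= V -> (0 < e)%N ->
  \sum_(0 <= v < (Num.truncn (2 * V)).+1 | dyadic V v) (e %| v)%N%:R <= 2 * V / e%:R :> R.
Proof.
move=> V0 e0; set n := Num.truncn _.
apply: (@le_trans _ _ (\sum_(0 <= v < n.+1 | (0 < v)%N) (e %| v)%N%:R)).
  rewrite big_mkcond [leRHS]big_mkcond /=; apply: ler_sum => v _.
  by case: ifP => [/(dyadic_gt0 V0) ->//|_]; case: ifP.
apply: (le_trans (count_multiples n e0)); rewrite ler_pM2r ?invr_gt0 ?ltr0n //.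
by rewrite truncn_le mulr_ge0.
Qed.

Lemma count_dyadic (V : R) : 0 <= V ->
  \sum_(0 <= v < (Num.truncn (2 * V)).+1 | dyadic V v) 1 <= 2 * V.
Proof.
move=> V0; have := dyadic_multiples V0 (ltn0Sn 0); rewrite divr1.
by under eq_bigr do rewrite dvd1n.
Qed.

Definition near_int (th : R) (T : nat) (d : R) (n : nat) : bool :=
  [exists s : 'I_T.+1, (0 < s)%N && (dist ((s * n)%:R * th) <= d)].

Lemma near_intP th T d n :
  reflect (exists s, [/\ (0 < s)%N, (s <= T)%N & dist ((s * n)%:R * th) <= d])
    (near_int th T d n).
Proof.
apply: (iffP existsP) => [[s /andP[s0 hs]]|[s [s0 sT hs]]].
  by exists s; split => //; rewrite -ltnS.
have sT' : (s < T.+1)%N by [].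
by exists (Ordinal sT'); rewrite s0.
Qed.

(** Two solutions [j > i] with the same [s] give [z = s g (j - i) (j + i) > 0], at distance at most
    [2 d] from an integer. Both [s] and [j - i] divide [z], and with [z] they determine [j + i];
    hence the multiplicity [D * D]. *)
Lemma sum_close_pairs (th W d : R) (T g D : nat) (n := (Num.truncn (2 * W)).+1)
    (c := fun s w : nat => (dyadic W w && (dist ((s * (g * w ^ 2))%:R * th) <= d))%R%:R : R) :
  0 <= W -> (0 < g)%N ->
  (forall z, (0 < z <= T * g * n ^ 2)%N -> (size (divisors z) <= D)%N) ->
  \sum_(1 <= s < T.+1) \sum_(0 <= j < n) \sum_(0 <= i < j) c s j * c s i
  <= (D * D)%:R * \sum_(z < (Num.truncn (4 * T%:R * g%:R * W ^+ 2)).+1)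
       (dist (z%:R * th) <= 2 * d)%R%:R.
Proof.
move=> W0 g0 hD; set Z := Num.truncn (_ * W ^+ 2).
have j2W j : dyadic W j -> j%:R <= 2 * W by case/andP.
pose A (p : 'I_T.+1 * ('I_n * 'I_n)) := [&& (0 < p.1)%N, (p.2.2 < p.2.1)%N,
  dyadic W p.2.1, dyadic W p.2.2, dist ((p.1 * (g * p.2.1 ^ 2))%:R * th) <= d
  & dist ((p.1 * (g * p.2.2 ^ 2))%:R * th) <= d].
pose phi (p : 'I_T.+1 * ('I_n * 'I_n)) := (p.1 * g * ((p.2.1 - p.2.2) * (p.2.1 + p.2.2)))%N.
have phiE p : A p -> (phi p = p.1 * (g * p.2.1 ^ 2) - p.1 * (g * p.2.2 ^ 2))%N.
  by move=> _; rewrite /phi -!mulnBr -subn_sqr mulnA.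
apply: (@le_trans _ _ (\sum_(p | A p) (dist ((phi p)%:R * th) <= 2 * d)%R%:R)).
  rewrite big_geq_mkord /=.
  under eq_bigr => s _ do rewrite big_mkord.
  apply: (@le_trans _ _ (\sum_(s < T.+1 | (0 < s)%N) \sum_(j < n) \sum_(i < n | (i < j)%N)
     c s j * c s i)).
    apply: ler_sum => s _; apply: ler_sum => j _.
    have jn : (j <= n)%N by rewrite ltnW.
    by rewrite (big_nat_widen _ _ _ _ _ jn) big_mkord.
  have E (s : 'I_T.+1) : \sum_(j < n) \sum_(i < n | (i < j)%N) c s j * c s i =
      \sum_(p : 'I_n * 'I_n | (p.2 < p.1)%N) c s p.1 * c s p.2.
    by rewrite pair_big_dep.
  rewrite (eq_bigr _ (fun s _ => E s)) pair_big_dep /= /A big_mkcond [leRHS]big_mkcond /=.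
  apply: ler_sum => [[s [j i]]] _ /=; case: (ltnP 0 s) => s0 //=.
  case: (ltnP i j) => ij //=; rewrite /c.
  case: (boolP (dyadic W j)) => Wj /=; last by rewrite mul0r.
  case: (boolP (dyadic W i)) => Wi /=; last by rewrite mulr0.
  case: (lerP (dist ((s * (g * j ^ 2))%:R * th)) d) => dj /=; last by rewrite mul0r.
  case: (lerP (dist ((s * (g * i ^ 2))%:R * th)) d) => di /=; last by rewrite mulr0.
  rewrite mulr1 ler1n lt0b /phi /= -mulnA -subn_sqr mulnBr mulnBr
    natrB ?leq_mul ?leq_sqr ?(ltnW ij) //.
  rewrite mulrBl; apply: le_trans (distB _ _) _; rewrite mulr2n mulrDl mul1r; exact: lerD.
have phi_le p : A p -> (0 < phi p)%N /\ (phi p <= p.1 * g * p.2.1 ^ 2)%N.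
  move=> /and5P[s0 ij _ _ _]; rewrite /phi !muln_gt0 s0 g0 subn_gt0 ij
    addn_gt0 (leq_ltn_trans _ ij) //.
  by rewrite -subn_sqr leq_mul2l leq_subr orbT.
apply: (@sum_fiber R _ A phi Z.+1 (D * D) predT
  (fun z => (dist (z%:R * th) <= 2 * d)%R%:R)) => //.
  move=> p Ap; rewrite andbT ltnS truncn_ge_nat ?mulr_ge0 ?sqr_ge0 //.
  have [_] := phi_le _ Ap; rewrite -(ler_nat R) => /le_trans; apply.
  have /and5P[_ _ Wj _ _] := Ap.
  have j2 : (nat_of_ord p.2.1 ^ 2)%:R <= 4 * W ^+ 2.
    rewrite natrX (_ : 4 * W ^+ 2 = (2 * W) ^+ 2); last by ring.
    by rewrite ler_pXn2r ?nnegrE ?mulr_ge0 // j2W.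
  rewrite (natrM _ (p.1 * g)%N) (natrM _ p.1 g).
  have sT : (nat_of_ord p.1)%:R <= T%:R :> R by rewrite ler_nat -ltnS.
  rewrite [leRHS](_ : _ = T%:R * g%:R * (4 * W ^+ 2)); last by ring.
  by apply: ler_pM j2 => //; rewrite ler_wpM2r.
move=> z zZ _; have [->|z0] := posnP z.
  rewrite (_ : #|_| = 0%N) //; apply: eq_card0 => p; rewrite !inE.
  by apply/negP => /andP[/phi_le[h _] /eqP e]; rewrite e in h.
(* An element of the fiber bounds [z] by [T * g * n ^ 2], the range of [hD]; an empty fiber is
   trivial. *)
have [A0|[p0 Ap0]] : (forall p, A p -> phi p != z) \/ exists p, A p /\ phi p = z.
  have [|n0] := pselect (exists p, A p /\ phi p = z); first by right.
  by left => p Ap; apply/eqP => e; apply: n0; exists p.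
  rewrite (_ : #|_| = 0%N) //; apply: eq_card0 => p; rewrite !inE.
  by apply/negP => /andP[/A0/negP h /eqP e]; apply: h; apply/eqP.
have zD : (size (divisors z) <= D)%N.
  apply: hD; rewrite z0 /=; case: Ap0 => /phi_le[_ h] <-; apply: leq_trans h _.
  by apply: leq_mul; [rewrite leq_mul2r -ltnS ltn_ord orbT | rewrite leq_sqr ltnW].
apply: leq_trans (leq_mul zD zD); rewrite -(size_allpairs pair).
apply: (@card_le_size _ _ _ (fun p : 'I_T.+1 * ('I_n * 'I_n) =>
  (nat_of_ord p.1, p.2.1 - p.2.2)%N)).
  move=> [s [j i]] [s' [j' i']]; rewrite !inE /= => /andP[/and5P[s0 ij _ _ _] /eqP e].
  move=> /andP[/and5P[/= s0' ij' _ _ _] /eqP e'] [es eji].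
  have {}es : s = s' by apply: val_inj.
  subst s'; rewrite /= in s0 ij; rewrite /phi /= -eji in e'; rewrite /phi /= in e.
  have ps : (0 < s * g * (j - i))%N by rewrite !muln_gt0 s0 g0 subn_gt0.
  have eij : (j + i = j' + i')%N 
    by apply/eqP; rewrite -(eqn_pmul2l ps) -!mulnA mulnA e mulnA -e' !mulnA.
  congr pair; congr pair; apply: val_inj => /=; lia.
move=> [s [j i]] /= /andP[_ /eqP e]; apply/allpairsP; exists (nat_of_ord s, j - i)%N; split => //=.
  by rewrite -dvdn_divisors // -e /phi /= -mulnA dvdn_mulr.
by rewrite -dvdn_divisors // -e /phi /= dvdn_mull // dvdn_mulr.
Qed.

Variables (a : int) (q : nat).
Hypotheses (q0 : (0 < q)%N) (caq : coprimez a q).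
Let th : R := a%:~R / q%:R.

Lemma near_int_small T d (n : nat) : (0 < n)%N -> (T * n < q)%N -> q%:R * d < 1 ->
  ~~ near_int th T d n.
Proof.
move=> n0 Tnq qd; apply/negP => /near_intP[s [s0 sT hs]].
have snq : (0 < s * n < q)%N by rewrite muln_gt0 s0 n0 (leq_ltn_trans _ Tnq) // leq_mul2r sT orbT.
have := frac_far R snq caq; rewrite -/th.
have := ler_wpM2l (ler0n R q) hs; lra.
Qed.

End Count.

Lemma ler_sum_subset (R : numDomainType) (I : eqType) (s s' : seq I) (F : I -> R) :
  (forall i, 0 <= F i) -> uniq s -> uniq s' -> {subset s <= s'} ->
  \sum_(i <- s) F i <= \sum_(i <- s') F i.
Proof.
move=> F0 us us' ss'; rewrite [leRHS](bigID (mem s)) /= -[X in _ <= X + _]big_filter.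
rewrite (@perm_big _ _ _ _ [seq i <- s' | i \in s] s) ?lerDl ?sumr_ge0 //.
apply: uniq_perm; rewrite ?filter_uniq // => i; rewrite mem_filter.
by case: (boolP (i \in s)) => // /ss' ->.
Qed.

Section Count2.
Variable R : realType.
Variables (a : int) (q : nat).
Hypotheses (q0 : (0 < q)%N) (caq : coprimez a q).
Let th : R := a%:~R / q%:R.

(** Cauchy-Schwarz over [s]: the diagonal gives the term [T], the pairs are counted by
    [sum_close_pairs] and [count_near_frac]. The single quantity [P] bounds both the width of the
    window modulo [q] and the number of periods covered by [z], up to constants; [tau] stands in for
    the square root of [T]. *)
Lemma count_near_int (W d P tau : R) (T g D : nat) :
  0 <= W -> (0 < g)%N -> 0 <= tau -> T%:R <= tau ^+ 2 -> 0 <= d ->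
  q%:R * d <= P -> T%:R * g%:R * W ^+ 2 / q%:R <= P ->
  (forall z, (0 < z <= T * g * (Num.truncn (2 * W)).+1 ^ 2)%N -> (size (divisors z) <= D)%N) ->
  \sum_(0 <= w < (Num.truncn (2 * W)).+1 | dyadic W w) (near_int th T d (g * w ^ 2))%:R
    <= T%:R + 2 * tau * D%:R * (4 * P + 2).
Proof.
move=> W0 g0 tau0 Ttau d0 qd PE hD; set n := (Num.truncn _).+1 in hD *.
have qR : 1 <= q%:R :> R by rewrite ler1n.
have qp : 0 < q%:R :> R by rewrite ltr0n.
pose c s w : R := (dyadic W w && (dist ((s * (g * w ^ 2))%:R * th) <= d))%R%:R.
pose nu s := \sum_(0 <= w < n) c s w.
set S := \sum_(1 <= s < T.+1) nu s.
apply: (@le_trans _ _ S).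
  rewrite /S /nu exchange_big /= big_mkcond /=; apply: ler_sum => w _.
  have c0 : 0 <= \sum_(1 <= s < T.+1) c s w by apply: sumr_ge0 => s _; rewrite /c.
  case: ifP => // Ww; case: (boolP (near_int _ _ _ _)) => // /near_intP[s [s0 sT hs]].
  rewrite (bigD1_seq s) ?mem_index_iota ?iota_uniq ?s0 //=.
  by rewrite /c Ww hs lerDl sumr_ge0 // => i _; rewrite /c.
have S0 : 0 <= S by apply: sumr_ge0 => s _; apply: sumr_ge0 => w _; rewrite /c.
have Z0 : 0 <= 4 * T%:R * g%:R * W ^+ 2 by rewrite !mulr_ge0 ?sqr_ge0.
set Nz := \sum_(z < (Num.truncn (4 * T%:R * g%:R * W ^+ 2)).+1)
   (dist (z%:R * th) <= 2 * d)%R%:R : R.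
have P0 : 0 <= P by apply: le_trans PE; rewrite divr_ge0 ?mulr_ge0 ?sqr_ge0.
have NzP : Nz <= (4 * P + 2) * (4 * P + 1).
  have eta0 : 0 <= 2 * (q%:R * d) by rewrite !mulr_ge0.
  have -> : Nz = \sum_(z < (Num.truncn (4 * T%:R * g%:R * W ^+ 2)).+1)
      (q%:R * dist (z%:R * (a%:~R / q%:R)) <= 2 * (q%:R * d))%R%:R.
    by apply: eq_bigr => z _; rewrite (_ : 2 * (q%:R * d) = q%:R * (2 * d)) ?ler_pM2l //; ring.
  apply: (le_trans (count_near_frac _ q0 caq eta0)); apply: ler_pM; try lra.
    by rewrite addr_ge0 ?divr_ge0.
  rewrite -natr1 mulrDl mul1r -addrA; apply: lerD.
    rewrite ler_pdivrMr //; apply: (@le_trans _ _ (4 * T%:R * g%:R * W ^+ 2)).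
      by rewrite truncn_le.
    by move: PE; rewrite ler_pdivrMr //; lra.
  by have : q%:R^-1 <= 1 :> R by [rewrite invf_le1]; lra.
have hpairs := @sum_close_pairs R th W d T g D W0 g0 hD; rewrite -/n -/Nz in hpairs.
have SS : S ^+ 2 <= T%:R * (S + 2 * ((D * D)%:R * Nz)).
  apply: (le_trans (sqr_sum_le _ _)); rewrite ler_wpM2l //.
  have -> : \sum_(1 <= s < T.+1) nu s ^+ 2 = S +
     2 * \sum_(1 <= s < T.+1) \sum_(0 <= j < n) \sum_(0 <= i < j) c s j * c s i.
    rewrite mulr_sumr /S -big_split /=; apply: eq_bigr => s _.
    rewrite /nu sqr_sum_triangle -mulr_natl; congr (_ + _).
    by apply: eq_bigr => w _; rewrite /c -natrX; case: (_ && _).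
  by rewrite lerD2l ler_pM2l.
rewrite natrM in SS.
set B := 2 * tau * D%:R * (4 * P + 2).
have B0 : 0 <= B by rewrite /B !mulr_ge0 //; lra.
rewrite leNgt; apply/negP => hS.
have h1 : T%:R * (2 * (D%:R * D%:R * Nz)) <= B ^+ 2.
  have -> : B ^+ 2 = tau ^+ 2 * (2 * (D%:R * D%:R * (2 * (4 * P + 2) ^+ 2))).
    by rewrite /B; ring.
  apply: ler_pM => //.
    by rewrite !mulr_ge0 // /Nz sumr_ge0.
  rewrite ler_pM2l // ler_wpM2l ?mulr_ge0 //; apply: (le_trans NzP); nra.
have T0 : 0 <= T%:R :> R by [].
have h2 : B < S - T%:R by lra.
have h3 : B * B <= S * (S - T%:R) - (S - T%:R - B) * B by nra.
nra.
Qed.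

(* When the dichotomy produces a denominator [y0], the solutions [v] are sorted according to
   [g = gcdn y0 (v ^ 2)]; those with a given [g] are multiples of [sqr_cover g]. *)
Lemma count_near_int_sqr (V d Lam : R) (T w D : nat)
   (Y := Num.truncn (4 * T%:R * V ^+ 2)) :
  1 <= V -> 0 < d -> 0 < Lam -> (0 < T)%N -> (0 < w)%N ->
  (forall z, (0 < z <= 2 * Y)%N -> (size (divisors z) <= D)%N) ->
  \sum_(0 <= v < (Num.truncn (2 * V)).+1 | dyadic V v) (near_int th T d ((v * w) ^ 2))%:R
  <= D%:R * (24 * Y%:R * d) + D%:R * (2 * V / Lam) +
     \sum_(1 <= e < (Num.truncn Lam).+1) \sum_(g <- divisors (e ^ 2))
       (2 * V / e%:R) * (near_int th T (d * g%:R / V ^+ 2) (g * w ^ 2))%:R.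
Proof.
move=> V1 d0 L0 T0 w0 hD; have V0 : 0 <= V by lra.
have TR : 1 <= T%:R :> R by rewrite ler1n.
set n := (Num.truncn (2 * V)).+1.
have VV : 1 <= V ^+ 2 by rewrite exprn_ege1.
have Y0 : (0 < Y)%N by rewrite truncn_gt0; nra.
set M3 := \sum_(1 <= e < _) _.
have M30 : 0 <= M3.
  rewrite /M3; apply: sumr_ge0 => e _; apply: sumr_ge0 => g _.
  by rewrite !mulr_ge0 ?invr_ge0.
have M20 : 0 <= D%:R * (2 * V / Lam) by rewrite mulr_ge0 // divr_ge0 ?mulr_ge0 // ltW.
have M10 : 0 <= D%:R * (24 * Y%:R * d) by rewrite !mulr_ge0 // ltW.
pose be : R := (w ^ 2)%:R * th.
have yE s v : (s * (v * w) ^ 2)%:R * th = (s * v ^ 2)%:R * be.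
  by rewrite /be mulrA -natrM expnMn mulnA.
have sv_le s v : (s <= T)%N -> dyadic V v -> (s * v ^ 2 <= Y)%N.
  move=> sT /andP[_ vV]; rewrite truncn_ge_nat; last by rewrite !mulr_ge0 ?sqr_ge0.
  rewrite natrM natrX (_ : 4 * T%:R * V ^+ 2 = T%:R * (2 * V) ^+ 2); last by ring.
  by apply: ler_pM => //; rewrite ?ler_nat ?exprn_ge0 // ler_pXn2r ?nnegrE ?mulr_ge0.
have vgt0 v : dyadic V v -> (0 < v)%N by apply: dyadic_gt0.
(* In the case [gen], [v] divides [y = s v^2], so each [y] accounts for at most [D] values of
   [v]. *)
have [y0 [y00 y0Y [gen|exc]]] := near_int_dichotomy be Y0 d0.
  apply: (@le_trans _ _ (D%:R * (24 * Y%:R * d))); last by lra.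
  apply: (@le_trans _ _ (\sum_(0 <= v < n | dyadic V v) \sum_(1 <= y < Y.+1)
      (v %| y)%N%:R * (dist (y%:R * be) <= d)%R%:R)).
    apply: ler_sum => v Vv; have v0 := vgt0 _ Vv.
    have s0 : 0 <= \sum_(1 <= y < Y.+1) (v %| y)%N%:R * (dist (y%:R * be) <= d)%R%:R :> R.
      by apply: sumr_ge0 => y _; rewrite mulr_ge0.
    case: (boolP (near_int _ _ _ _)) => // /near_intP[s [sp sT]]; rewrite yE => hs.
    rewrite (bigD1_seq (s * v ^ 2)%N) ?iota_uniq //=; last first.
      by rewrite mem_index_iota muln_gt0 sp expn_gt0 v0 /= ltnS sv_le.
    have -> : (v %| s * v ^ 2)%N by rewrite dvdn_mull // dvdn_exp.
    by rewrite hs mulr1 lerDl; apply: sumr_ge0 => y _; rewrite mulr_ge0.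
  rewrite exchange_big /=; apply: (@le_trans _ _ (\sum_(1 <= y < Y.+1)
      D%:R * (dist (y%:R * be) <= d)%R%:R)); last by rewrite -mulr_sumr ler_wpM2l.
  apply: ler_sum_nat => y /andP[yp yY]; rewrite -mulr_suml ler_wpM2r //.
  have yD : (size (divisors y) <= D)%N by apply: hD; rewrite yp /=; lia.
  apply: le_trans (_ : (size (divisors y))%:R <= _); last by rewrite ler_nat.
  rewrite big_mkord.
  have -> : \sum_(v < n | dyadic V v) (v %| y)%N%:R =
     #|[pred v : 'I_n | dyadic V v && (v %| y)%N]|%:R :> R.
    rewrite -sum1_card natr_sum big_mkcond [RHS]big_mkcond /=.
    by apply: eq_bigr => v _; rewrite !inE; case: (dyadic V v); case: (_ %| _)%N.
  rewrite ler_nat; apply: (@card_le_size _ _ _ (@nat_of_ord _)).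
    by move=> ? ? _ _; exact: val_inj.
  by move=> v /andP[_ vy]; rewrite -dvdn_divisors.
apply: (@le_trans _ _ (D%:R * (2 * V / Lam) + M3)); last by lra.
pose ad g := near_int th T (d * g%:R / V ^+ 2) (g * w ^ 2).
apply: (@le_trans _ _ (\sum_(0 <= v < n | dyadic V v) \sum_(g <- divisors y0)
    (sqr_cover g %| v)%N%:R * (ad g)%:R)).
  apply: ler_sum => v Vv; have v0 := vgt0 _ Vv.
  have s0 : 0 <= \sum_(g <- divisors y0) (sqr_cover g %| v)%N%:R * (ad g)%:R :> R.
    by apply: sumr_ge0 => y _; rewrite mulr_ge0.
  case: (boolP (near_int _ _ _ _)) => // /near_intP[s [sp sT]]; rewrite yE => hs.
  have sv0 : (0 < s * v ^ 2)%N by rewrite muln_gt0 sp expn_gt0 v0.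
  have [y0d hd] := exc (s * v ^ 2)%N (introT andP (conj sv0 (sv_le _ _ sT Vv))) hs.
  (* From [y0 | s v^2] and the coprimality of [y0 / g] with [v^2 / g] follows [y0 / g | s]; this
     quotient [s1] is the witness for [near_int] at [g w^2]. *)
  set g := gcdn y0 (v ^ 2).
  have g0 : (0 < g)%N by rewrite gcdn_gt0 y00.
  have /dvdnP[s1 s1E] : (g %| y0)%N := dvdn_gcdl _ _.
  have /dvdnP[i' iE] : (g %| v ^ 2)%N := dvdn_gcdr _ _.
  have c1 : coprime s1 i'.
    by rewrite /coprime -(eqn_pmul2r g0) muln_gcdl -s1E -iE mul1n.
  have s10 : (0 < s1)%N by move: y00; rewrite s1E muln_gt0 => /andP[].
  have s1s : (s1 %| s)%N.
    by move: y0d; rewrite s1E iE mulnA dvdn_pmul2r // Gauss_dvdl.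
  have adg : ad g.
    apply/near_intP; exists s1; split => //.
      by apply: leq_trans sT; exact: dvdn_leq.
    have -> : (s1 * (g * w ^ 2))%:R * th = y0%:R * be.
      by rewrite /be mulrA -natrM s1E mulnA.
    rewrite ler_pdivlMr ?(lt_le_trans ltr01 VV) //.
    have gR : 0 < g%:R :> R by rewrite ltr0n.
    (* Going from [s v^2] down to [y0] divides the distance by [s v^2 / y0 >= v^2 / g]; hence the
       radius [d g / V^2]. *)
    have k1 : ((s * v ^ 2) %/ y0)%:R * g%:R >= V ^+ 2.
      rewrite -natrM; apply: (@le_trans _ _ (v ^ 2)%:R).
        by rewrite natrX; case/andP: Vv => hv _; rewrite ler_pXn2r ?nnegrE // ltW.
      rewrite ler_nat iE s1E mulnA divnMr // leq_mul2r; apply/orP; right.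
      case/dvdnP: s1s => s2 s2E; rewrite s2E -mulnA mulnCA mulKn //.
      by rewrite leq_pmull //; move: sp; rewrite s2E muln_gt0 => /andP[].
    have := ler_wpM2l (dist_ge0 (y0%:R * be)) k1; have := ler_wpM2r (ltW gR) hd; lra.
  have gD : g \in divisors y0 by rewrite -dvdn_divisors // dvdn_gcdl.
  rewrite (bigD1_seq g) ?divisors_uniq //= adg sqr_cover_dvd ?dvdn_gcdr // mulr1.
  by rewrite lerDl sumr_ge0 // => ? _; rewrite mulr_ge0.
rewrite exchange_big /=.
apply: (@le_trans _ _ (\sum_(g <- divisors y0) (2 * V / (sqr_cover g)%:R) * (ad g)%:R)).
  rewrite big_seq [leRHS]big_seq; apply: ler_sum => g; rewrite -dvdn_divisors // => gy.
  rewrite -mulr_suml ler_wpM2r // dyadic_multiples // sqr_cover_gt0 //.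
  exact: dvdn_gt0 gy.
(* For large covers, each of the at most [D] divisors of [y0] leaves at most [2 V / Lam] values of
   [v]. *)
rewrite (bigID (fun g => Lam < (sqr_cover g)%:R)) /=; apply: lerD.
  apply: (@le_trans _ _ (\sum_(g <- divisors y0) 2 * V / Lam)).
    rewrite big_mkcond /=; apply: ler_sum => g _; case: ifP => [h|_]; last first.
      by rewrite divr_ge0 ?mulr_ge0 // ltW.
    apply: (@le_trans _ _ (2 * V / (sqr_cover g)%:R)).
      by rewrite ler_piMr ?lern1 ?leq_b1 // divr_ge0 ?mulr_ge0.
    rewrite ler_wpM2l ?mulr_ge0 // lef_pV2 ?posrE //; first exact: ltW.
    exact: lt_trans h.
  rewrite big_const_seq count_predT iter_addr_0 -[X in X <= _]mulr_natl ler_wpM2r //.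
    by rewrite divr_ge0 ?mulr_ge0 // ltW.
  by rewrite ler_nat hD // y00 y0Y.
rewrite /M3.
have cov g : (g %| y0)%N -> (0 < g)%N by move=> gy; exact: dvdn_gt0 gy.
pose h e g : R := 2 * V / e%:R * (ad g)%:R.
have h0 e g : 0 <= h e g by rewrite /h !mulr_ge0 ?invr_ge0.
apply: (@le_trans _ _ (\sum_(g <- divisors y0) \sum_(1 <= e < (Num.truncn Lam).+1)
   (sqr_cover g == e)%:R * h e g)).
  rewrite big_mkcond big_seq [leRHS]big_seq; apply: ler_sum => g.
  rewrite -dvdn_divisors // => gy.
  have p0 : 0 <= \sum_(1 <= e < (Num.truncn Lam).+1) (sqr_cover g == e)%:R * h e g.
    by apply: sumr_ge0 => e _; rewrite mulr_ge0.
  case: ifP => //; rewrite -leNgt => hl.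
  rewrite (bigD1_seq (sqr_cover g)) ?iota_uniq //=; last first.
    by rewrite mem_index_iota sqr_cover_gt0 ?cov // ltnS truncn_ge_nat // ltW.
  by rewrite eqxx mul1r lerDl sumr_ge0 // => e _; rewrite mulr_ge0.
rewrite exchange_big /=; apply: ler_sum_nat => e /andP[e1 _].
apply: (@le_trans _ _ (\sum_(g <- divisors y0 | sqr_cover g == e) h e g)).
  by rewrite [leRHS]big_mkcond /=; apply: ler_sum => g _; case: eqP; rewrite ?mul1r ?mul0r.
(* [y0] depends on [w]. Enlarging the divisors of [y0] with cover [e] to all divisors of [e ^ 2]
   frees the range from [w], so that [w] can later be summed inside. *)
rewrite -[leLHS]big_filter; apply: (@ler_sum_subset _ _ _ _ (h e)) => //;
  rewrite ?filter_uniq ?divisors_uniq //.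
move=> g; rewrite mem_filter -dvdn_divisors // => /andP[/eqP <- /cov g0].
by rewrite -dvdn_divisors ?expn_gt0 ?sqr_cover_gt0 // dvdn_sqr_cover.
Qed.
End Count2.

Ltac nneg := first [assumption | by apply: ltW |
  lazymatch goal with
  | |- is_true (0 <= _ ^+ _) => first [exact: sqr_ge0 | apply: exprn_ge0; nneg]
  | |- is_true (0 <= _ * _) => apply: mulr_ge0; nneg
  | |- is_true (0 <= _^-1) => rewrite invr_ge0; nneg
  | |- is_true (0 <= _ + _) => apply: addr_ge0; nneg
  end | done].

Ltac pos := first [assumption |
  lazymatch goal with
  | |- is_true (0 < _ ^+ _) => apply: exprn_gt0; pos
  | |- is_true (0 < _ * _) => apply: mulr_gt0; pos
  | |- is_true (0 < _^-1) => rewrite invr_gt0; pos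
  end | done].

Lemma ler_expn (R : numDomainType) n (x y : R) : 0 <= x -> x <= y -> x ^+ n <= y ^+ n.
Proof. by move=> x0 xy; rewrite lerXn2r ?nnegrE // (le_trans x0). Qed.

Lemma count_near_int_vw (R : realType) (a : int) (q D T : nat) (V W L om U tau d : R)
    (th := a%:~R / q%:R : R) :
  (0 < q)%N -> coprimez a q -> 1 <= V -> 1 <= W -> 1 <= L -> 100 <= om ->
  D%:R <= om ->
  (forall z, (0 < z)%N -> z%:R <= U -> (size (divisors z) <= D)%N) ->
  32 * L ^+ 2 * V ^+ 2 * W ^+ 2 * om ^+ 18 <= U ->
  L ^+ 4 * V ^+ 3 * W ^+ 2 * om ^+ 25 <= q%:R ^+ 2 ->
  L ^+ 3 * W * om ^+ 28 <= q%:R ->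
  L ^+ 6 * om ^+ 57 <= q%:R ->
  1 <= tau -> tau <= 2 * L * om ^+ 5 -> (0 < T)%N -> T%:R <= tau ^+ 2 ->
  0 < d -> d <= tau ^+ 2 * (V * W) ^+ 2 / q%:R ^+ 2 ->
  \sum_(0 <= w < (Num.truncn (2 * W)).+1 | dyadic W w)
   \sum_(0 <= v < (Num.truncn (2 * V)).+1 | dyadic V v) (near_int th T d ((v * w) ^ 2))%:R
  <= V * W * tau / (L * om ^+ 6).
Proof.
move=> q0 caq V1 W1 L1 om4 Dom hD hU h1 h2 h4 tau1 tauL T0 Ttau d0 dle.
have om0 : 0 < om by exact: lt_le_trans om4.
have om1 : 1 <= om by apply: le_trans om4; rewrite ler1n.
have omk k : (k <= 100)%N -> k%:R <= om by move=> h; apply: le_trans om4; rewrite ler_nat.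
have L0 := lt_le_trans ltr01 L1.
have V0 := lt_le_trans ltr01 V1.
have W0 := lt_le_trans ltr01 W1.
have t0 := lt_le_trans ltr01 tau1.
have qR : 0 < q%:R :> R by rewrite ltr0n.
have omX k : 1 <= om ^+ k by rewrite exprn_ege1.
have omX0 k : 0 < om ^+ k by rewrite exprn_gt0.
(* Chosen so that the covers above [Lam] cost about [om V W / Lam = r7 / om]. Moreover [tau * Lam]
   no longer depends on [tau]. *)
pose Lam := L * om ^+ 9 / tau.
have LamE : Lam * tau = L * om ^+ 9 by rewrite /Lam divfK // gt_eqF.
have Lam0 : 0 < Lam by rewrite /Lam divr_gt0 ?mulr_gt0.
have Lam2 : tau ^+ 2 * Lam ^+ 2 = L ^+ 2 * om ^+ 18.
  by rewrite -exprMn mulrC LamE exprMn -exprM.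
have Lam1 : 1 <= Lam.
  rewrite /Lam ler_pdivlMr // mul1r; apply: (le_trans tauL).
  have -> : L * om ^+ 9 = L * om ^+ 5 * om ^+ 4 by ring.
  have : L * om ^+ 5 * om <= L * om ^+ 5 * om ^+ 4.
    by rewrite ler_pM2l ?mulr_gt0 // -{1}[om]expr1 ler_weXn2l.
  have z0 : 0 < L * om ^+ 5 by rewrite mulr_gt0.
  by apply: le_trans; rewrite -mulrA mulrC ler_pM2l // omk.
set Y := Num.truncn (4 * T%:R * V ^+ 2).
have Yle : Y%:R <= 4 * tau ^+ 2 * V ^+ 2.
  apply: (@le_trans _ _ (4 * T%:R * V ^+ 2)).
    by rewrite truncn_le mulr_ge0 ?sqr_ge0 // mulr_ge0.
  by rewrite ler_pM2r ?exprn_gt0 // ler_pM2l.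
have tau2 : tau ^+ 2 <= 4 * L ^+ 2 * om ^+ 10.
  have -> : 4 * L ^+ 2 * om ^+ 10 = (2 * L * om ^+ 5) ^+ 2 by ring.
  by apply: ler_expn => //; exact: ltW.
have W21 : 1 <= W ^+ 2 by rewrite exprn_ege1.
have V21 : 1 <= V ^+ 2 by rewrite exprn_ege1.
have hDY z : (0 < z <= 2 * Y)%N -> (size (divisors z) <= D)%N.
  move=> /andP[z0 zY]; apply: hD => //; apply: le_trans hU.
  have : z%:R <= 2 * Y%:R :> R by rewrite -natrM ler_nat.
  have h : 4 * tau ^+ 2 * V ^+ 2 <= 16 * L ^+ 2 * om ^+ 10 * V ^+ 2.
    by rewrite ler_pM2r ?exprn_gt0 //; move: tau2; clear; lra.
  have h' : 32 * L ^+ 2 * om ^+ 10 * V ^+ 2 <= 32 * L ^+ 2 * V ^+ 2 * W ^+ 2 * om ^+ 18.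
    have -> : 32 * L ^+ 2 * V ^+ 2 * W ^+ 2 * om ^+ 18 =
      (32 * L ^+ 2 * om ^+ 10 * V ^+ 2) * (W ^+ 2 * om ^+ 8) by ring.
    rewrite ler_peMr //; first by nneg.
    by rewrite -[leLHS]mulr1; apply: ler_pM.
  by move: h h' Yle; clear; lra.
pose M3 w := \sum_(1 <= e < (Num.truncn Lam).+1) \sum_(g <- divisors (e ^ 2))
   (2 * V / e%:R) * (near_int th T (d * g%:R / V ^+ 2) (g * w ^ 2))%:R.
apply: (@le_trans _ _ (\sum_(0 <= w < (Num.truncn (2 * W)).+1 | dyadic W w)
   (D%:R * (24 * Y%:R * d) + D%:R * (2 * V / Lam) + M3 w))).
  apply: ler_sum => w Ww; apply: count_near_int_sqr => //.
  exact: dyadic_gt0 (ltW W0) Ww.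
rewrite big_split /=.
set c1 := _ + D%:R * _.
have c10 : 0 <= c1.
  by rewrite /c1; nneg.
have -> : \sum_(0 <= w < (Num.truncn (2 * W)).+1 | dyadic W w) c1 =
    c1 * \sum_(0 <= w < (Num.truncn (2 * W)).+1 | dyadic W w) 1.
  by rewrite mulr_sumr; apply: eq_bigr => w _; rewrite mulr1.
set r := V * W * tau / (L * om ^+ 6).
have r0 : 0 < r by rewrite /r divr_gt0 ?mulr_gt0.
have rE : r = V * W * tau / (L * om ^+ 7) * om.
  by rewrite /r; field; rewrite !gt_eqF.
set r7 := V * W * tau / (L * om ^+ 7) in rE.
have r70 : 0 < r7 by rewrite /r7 divr_gt0 ?mulr_gt0.
have Lo7 : 0 < L * om ^+ 7 by rewrite mulr_gt0.
suff [hA hB] : c1 * \sum_(0 <= w < (Num.truncn (2 * W)).+1 | dyadic W w) 1 <= 2 * r7 /\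
    \sum_(0 <= w < (Num.truncn (2 * W)).+1 | dyadic W w) M3 w <= r7.
  have : 100 * r7 <= r7 * om by rewrite mulrC ler_pM2l.
  by move: hA hB r70; rewrite rE; clear; lra.
split.
  apply: (@le_trans _ _ (c1 * (2 * W))).
    by rewrite ler_wpM2l // count_dyadic // ltW.
  (* Equidistributed case: after cancelling [V W tau], the claim is [L V^3 W^2 tau^3 << q^2] up to
     powers of [om], and [tau <= 2 L om^5] makes it the hypothesis on [L^4 V^3 W^2]. *)
  have e1 : D%:R * (24 * Y%:R * d) * (2 * W) <= r7.
    apply: (@le_trans _ _ (om * (24 * (4 * tau ^+ 2 * V ^+ 2) *
        (tau ^+ 2 * (V * W) ^+ 2 / q%:R ^+ 2)) * (2 * W))).
      rewrite ler_pM2r ?mulr_gt0 //; apply: ler_pM => //; first by nneg.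
      by apply: ler_pM; first [nneg | by rewrite ler_pM2l].
    have -> : om * (24 * (4 * tau ^+ 2 * V ^+ 2) * (tau ^+ 2 * (V * W) ^+ 2 / q%:R ^+ 2)) * (2 * W)
       = 192 * om * tau ^+ 4 * V ^+ 4 * W ^+ 3 / q%:R ^+ 2 by field; rewrite gt_eqF.
    rewrite /r7 ler_pdivrMr ?exprn_gt0 // [leRHS]mulrAC ler_pdivlMr //.
    have tau3 : tau ^+ 3 <= 8 * L ^+ 3 * om ^+ 15.
      have -> : 8 * L ^+ 3 * om ^+ 15 = (2 * L * om ^+ 5) ^+ 3 by ring.
      by apply: ler_expn => //; exact: ltW.
    have -> : 192 * om * tau ^+ 4 * V ^+ 4 * W ^+ 3 * (L * om ^+ 7) =
      V * W * tau * (192 * om ^+ 8 * L * V ^+ 3 * W ^+ 2 * tau ^+ 3) by ring.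
    rewrite ler_pM2l ?mulr_gt0 //; apply: le_trans h1.
    apply: (@le_trans _ _ (192 * om ^+ 8 * L * V ^+ 3 * W ^+ 2 * (8 * L ^+ 3 * om ^+ 15))).
      by rewrite ler_pM2l //; pos.
    have -> : L ^+ 4 * V ^+ 3 * W ^+ 2 * om ^+ 25 =
      om ^+ 23 * L ^+ 4 * V ^+ 3 * W ^+ 2 * om ^+ 2 by ring.
    have -> : 192 * om ^+ 8 * L * V ^+ 3 * W ^+ 2 * (8 * L ^+ 3 * om ^+ 15) =
      om ^+ 23 * L ^+ 4 * V ^+ 3 * W ^+ 2 * 1536 by ring.
    by rewrite ler_pM2l; [move: om4; clear; nra | pos].
  have e2 : D%:R * (2 * V / Lam) * (2 * W) <= r7.
    apply: (@le_trans _ _ (om * (2 * V / Lam) * (2 * W))).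
      by rewrite ler_pM2r ?mulr_gt0 // ler_wpM2r ?divr_ge0 ?mulr_ge0 // ltW.
    have -> : om * (2 * V / Lam) * (2 * W) = 4 * (om * (V * W) / Lam) by ring.
    have -> : om * (V * W) / Lam = r7 / om.
      by rewrite /r7 /Lam; field; rewrite !gt_eqF.
    by rewrite mulrA ler_pdivrMr // mulrC ler_pM2l // omk.
  by rewrite /c1 mulrDl; move: e1 e2; clear; lra.
rewrite /M3 exchange_big /=.
have eL e : (e < (Num.truncn Lam).+1)%N -> e%:R <= Lam.
  by rewrite ltnS => h; rewrite -truncn_ge_nat // ltW.
have gL e g : (0 < e)%N -> e%:R <= Lam -> g \in divisors (e ^ 2) ->
    [/\ (0 < g)%N, g%:R <= e%:R ^+ 2 :> R & g%:R <= Lam ^+ 2].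
  move=> e0 he; rewrite -dvdn_divisors ?expn_gt0 ?e0 // => ge.
  have g0 : (0 < g)%N by apply: dvdn_gt0 ge; rewrite expn_gt0 e0.
  have h : g%:R <= e%:R ^+ 2 :> R by rewrite -natrX ler_nat dvdn_leq // expn_gt0 e0.
  by split => //; apply: (le_trans h); apply: ler_expn.
have wW w : dyadic W w -> w%:R ^+ 2 <= 4 * W ^+ 2.
  case/andP=> _ h; have -> : 4 * W ^+ 2 = (2 * W) ^+ 2 by ring.
  exact: ler_expn.
have qd g : q%:R * (d * g%:R / V ^+ 2) <= tau ^+ 2 * g%:R * W ^+ 2 / q%:R.
  apply: (@le_trans _ _ (q%:R * (tau ^+ 2 * (V * W) ^+ 2 / q%:R ^+ 2 * g%:R / V ^+ 2))).
    by rewrite ler_pM2l // ler_pM2r ?invr_gt0 ?exprn_gt0 // ler_wpM2r.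
  by rewrite le_eqVlt; apply/orP; left; apply/eqP; field; rewrite !gt_eqF.
(* The diagonal terms add up to about [V tau L om^11], which fits into [r7] once [W] exceeds a
   constant times [L^2 om^18]. Below the threshold [s g w^2 <= 4 L^2 om^18 W^2 < q], and
   [near_int_small] excludes every solution. *)
have [Wsmall|Wbig] := ltP W (L ^+ 2 * om ^+ 19).
  have small : 4 * L ^+ 2 * om ^+ 18 * W ^+ 2 < q%:R.
    apply: lt_le_trans h4.
    apply: (@lt_le_trans _ _ (4 * L ^+ 2 * om ^+ 18 * (L ^+ 2 * om ^+ 19) ^+ 2)).
      by rewrite ltr_pM2l; [rewrite ltr_pXn2r ?nnegrE //; nneg | pos].
    have -> : 4 * L ^+ 2 * om ^+ 18 * (L ^+ 2 * om ^+ 19) ^+ 2 = L ^+ 6 * om ^+ 56 * 4 by ring.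
    have -> : L ^+ 6 * om ^+ 57 = L ^+ 6 * om ^+ 56 * om by ring.
    by rewrite ler_pM2l; [exact: omk | pos].
  rewrite big_nat big1 ?ltW // => e /andP[e0 eE].
  have he := eL _ eE.
  rewrite big1 // => w Ww; rewrite big_seq big1 // => g ge.
  have [g0 g1 g2] := gL _ _ e0 he ge.
  have w0 := dyadic_gt0 (ltW W0) Ww.
  rewrite (negbTE (near_int_small (q := q) caq _ _ _)) ?mulr0 //.
  - by rewrite muln_gt0 g0 expn_gt0 w0.
  - rewrite -(ltr_nat R); apply: le_lt_trans small.
    rewrite mulnA natrM natrX natrM.
    have -> : 4 * L ^+ 2 * om ^+ 18 * W ^+ 2 = (tau ^+ 2 * Lam ^+ 2) * (4 * W ^+ 2).
      by rewrite Lam2; ring.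
    by apply: ler_pM; first [nneg | exact: wW | by apply: ler_pM].
  - apply: (le_lt_trans (qd g)); rewrite ltr_pdivrMr // mul1r; apply: le_lt_trans small.
    apply: (@le_trans _ _ (tau ^+ 2 * Lam ^+ 2 * W ^+ 2)).
      by rewrite ler_pM2r ?exprn_gt0 // ler_pM2l ?exprn_gt0.
    rewrite Lam2 -(mulrA 4) -(mulrA 4) ler_peMl ?ler1n //; nneg.
(* A bound uniform in [e] and [g]: against [g <= e^2] the weight [1 / e] leaves [g / e <= Lam] in
   the off-diagonal term. Summing over [e] and [g] then costs the factors [Lam] and [om]. *)
pose Q := 2 * V * (5 * tau ^+ 2 * om + 8 * tau ^+ 3 * om * Lam * W ^+ 2 / q%:R).
have Q0 : 0 <= Q.
  by rewrite /Q; nneg.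
apply: (@le_trans _ _ (\sum_(1 <= e < (Num.truncn Lam).+1) \sum_(g <- divisors (e ^ 2)) Q)).
  apply: ler_sum_nat => e /andP[e0 eE]; have he := eL _ eE.
  have eR : 1 <= e%:R :> R by rewrite ler1n.
  rewrite exchange_big /= big_seq [leRHS]big_seq; apply: ler_sum => g ge.
  have [g0 g1 g2] := gL _ _ e0 he ge.
  rewrite -mulr_sumr.
  have := @count_near_int R a q q0 caq W (d * g%:R / V ^+ 2)
     (tau ^+ 2 * g%:R * W ^+ 2 / q%:R) tau T g D (ltW W0) g0 (ltW t0) Ttau _ (qd g) _ _.
  move=> hx; apply: (le_trans (ler_wpM2l _ (hx _ _ _))).
  - by nneg.
  - by nneg.
  - by rewrite ler_pM2r ?invr_gt0 // ler_pM2r ?exprn_gt0 // ler_wpM2r.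
  - move=> z /andP[z0 zle]; apply: hD => //; apply: le_trans hU.
    apply: (@le_trans _ _ (T * g * (Num.truncn (2 * W)).+1 ^ 2)%:R); first by rewrite ler_nat.
    have n3 : (Num.truncn (2 * W)).+1%:R <= 3 * W.
      have : (Num.truncn (2 * W))%:R <= 2 * W by rewrite truncn_le mulr_ge0 // ltW.
      by rewrite -natr1; move: W1; clear; lra.
    rewrite natrM natrX natrM.
    apply: (@le_trans _ _ (tau ^+ 2 * Lam ^+ 2 * (3 * W) ^+ 2)).
      by apply: ler_pM; first [nneg | by apply: ler_pM | exact: ler_expn].
    rewrite Lam2; have -> : 32 * L ^+ 2 * V ^+ 2 * W ^+ 2 * om ^+ 18 =
      (L ^+ 2 * om ^+ 18) * (32 * V ^+ 2 * W ^+ 2) by ring.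
    rewrite ler_pM2l ?mulr_gt0 ?exprn_gt0 // exprMn.
    have : 1 * W ^+ 2 <= V ^+ 2 * W ^+ 2 by rewrite ler_wpM2r ?sqr_ge0.
    have := sqr_ge0 W; clear; lra.
  have -> : 2 * V / e%:R * (T%:R + 2 * tau * D%:R * (4 * (tau ^+ 2 * g%:R * W ^+ 2 / q%:R) + 2))
     = 2 * V * ((T%:R + 4 * (tau * D%:R)) / e%:R +
         8 * tau ^+ 3 * D%:R * (g%:R / e%:R) * W ^+ 2 / q%:R).
    by field; rewrite !gt_eqF // (lt_le_trans ltr01 eR).
  rewrite /Q ler_pM2l ?mulr_gt0 //; have e0R := lt_le_trans ltr01 eR.
  have tD : tau * D%:R <= tau * om by rewrite ler_pM2l.
  have tt : tau * om <= tau ^+ 2 * om.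
    by rewrite ler_pM2r // expr2 ler_peMr // ltW.
  have tt' : tau ^+ 2 <= tau ^+ 2 * om by rewrite ler_peMr // sqr_ge0.
  have t2om : 0 < tau ^+ 2 * om by rewrite mulr_gt0 ?exprn_gt0.
  apply: lerD.
    rewrite ler_pdivrMr // -mulrA.
    have : tau ^+ 2 * om <= tau ^+ 2 * om * e%:R by rewrite ler_peMr // ltW.
    by move: Ttau tD tt tt'; clear; lra.
  have ge' : g%:R / e%:R <= Lam.
    by rewrite ler_pdivrMr //; apply: (le_trans g1); rewrite expr2 ler_pM2r.
  rewrite ler_pM2r ?invr_gt0 // ler_pM2r ?exprn_gt0 //.
  by apply: ler_pM => //; first [nneg | by rewrite ler_pM2l //; pos].
have sumQ : \sum_(1 <= e < (Num.truncn Lam).+1) \sum_(g <- divisors (e ^ 2)) Q <= Lam * (om * Q).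
  apply: (@le_trans _ _ (\sum_(1 <= e < (Num.truncn Lam).+1) om * Q)).
    apply: ler_sum_nat => e /andP[e0 eE]; have he := eL _ eE.
    rewrite big_const_seq count_predT iter_addr_0 -[X in X <= _]mulr_natl ler_wpM2r //.
    apply: le_trans Dom; rewrite ler_nat; apply: hD; first by rewrite expn_gt0 e0.
    rewrite natrX; apply: le_trans hU; apply: (@le_trans _ _ (Lam ^+ 2)); first exact: ler_expn.
    apply: (@le_trans _ _ (tau ^+ 2 * Lam ^+ 2)); first by rewrite ler_peMl ?sqr_ge0 // exprn_ege1.
    rewrite Lam2.
    have -> : 32 * L ^+ 2 * V ^+ 2 * W ^+ 2 * om ^+ 18 =
      (L ^+ 2 * om ^+ 18) * (32 * (V ^+ 2 * W ^+ 2)) by ring.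
    apply: ler_peMr; first by nneg.
    have : 1 * 1 <= V ^+ 2 * W ^+ 2 by apply: ler_pM.
    by clear; lra.
  rewrite sumr_const_nat subn1 /= -[X in X <= _]mulr_natl ler_wpM2r //.
    by rewrite mulr_ge0 // ltW.
  by rewrite truncn_le ltW.
apply: (le_trans sumQ).
have -> : Lam * (om * Q) = 10 * V * om ^+ 2 * tau * (Lam * tau) +
    16 * V * om ^+ 2 * tau * (tau ^+ 2 * Lam ^+ 2) * W ^+ 2 / q%:R.
  by rewrite /Q; field; rewrite gt_eqF.
rewrite LamE Lam2.
have -> : r7 = r7 / 2 + r7 / 2 by field.
have VWt : 0 < V * tau by rewrite mulr_gt0.
apply: lerD.
  rewrite ler_pdivlMr // /r7 ler_pdivlMr //.
  have -> : 10 * V * om ^+ 2 * tau * (L * om ^+ 9) * 2 * (L * om ^+ 7) =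
     V * tau * (L ^+ 2 * om ^+ 18 * 20) by ring.
  have -> : V * W * tau = V * tau * W by ring.
  rewrite ler_pM2l //; apply: le_trans Wbig.
  have -> : L ^+ 2 * om ^+ 19 = L ^+ 2 * om ^+ 18 * om by ring.
  by rewrite ler_pM2l; [exact: omk | pos].
rewrite ler_pdivlMr // /r7 ler_pdivlMr //.
have -> : 16 * V * om ^+ 2 * tau * (L ^+ 2 * om ^+ 18) * W ^+ 2 / q%:R * 2 * (L * om ^+ 7) =
   V * W * tau * (32 * L ^+ 3 * W * om ^+ 27) / q%:R by field; rewrite gt_eqF.
rewrite ler_pdivrMr // ler_pM2l ?mulr_gt0 //; apply: le_trans h2.
have -> : 32 * L ^+ 3 * W * om ^+ 27 = L ^+ 3 * W * om ^+ 27 * 32 by ring.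
have -> : L ^+ 3 * W * om ^+ 28 = L ^+ 3 * W * om ^+ 27 * om by ring.
by rewrite ler_pM2l; [exact: omk | pos].
Qed.

(** * The sum over l *)

Section Core.
Variable R : realType.
Local Notation normc := (@Normc.normc R).
Local Notation expe := (@Defs.expe R).

Lemma interval_convex (J : interval R) (x y z : R) :
  x <= y -> y <= z -> x \in J -> z \in J -> y \in J.
Proof.
case: J => bl br xy yz; rewrite !itv_boundlr => /andP[h1 _] /andP[_ h2].
apply/andP; split; first by apply: le_trans h1 _; rewrite bnd_simp.
by apply: le_trans _ h2; rewrite bnd_simp.
Qed.

Lemma isum_range (B : R) (J : interval R) : exists a b : nat,
  [/\ (a <= b)%N, (b - a <= Num.truncn B)%N &
   forall f, isum B J f = \sum_(a <= n < b) f n].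
Proof.
have [|a [b [a1 ab bT h]]] := @convex_range (fun n => n%:R \in J) (Num.truncn B).
  move=> i j k /andP[ij jk]; apply: interval_convex; rewrite ler_nat //.
exists a, b; split => //; first lia.
move=> f; rewrite /isum (big_nat_widen _ _ _ _ _ bT) (big_nat_widenl _ _ _ _ _ a1).
rewrite [LHS]big_nat_cond [RHS]big_nat_cond; apply: eq_bigl => n /=.
case: (boolP (1 <= n < _)%N) => [/andP[n1 nT]|//].
have hn : (1 <= n <= Num.truncn B)%N by rewrite n1 -ltnS.
by rewrite (h _ hn) /= andbC.
Qed.

(** Cauchy-Schwarz over the multiples, followed by Weyl differencing and the reciprocal sum. Of
    [om ^+ 3], one factor pays for the divisors, one for the harmonic sum and one for the
    constants. *)
Lemma tsum_inner (A B c X : R) (a b l H K D : nat) (om L : R) :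
  (a <= b)%N -> (b - a <= H)%N -> H%:R <= X -> (2 * l * H <= K)%N -> (0 < K)%N -> 0 < X ->
  l%:R <= L -> K%:R <= 2 * L * X -> 100 <= om -> D%:R <= om -> harm R (2 * K) <= om ->
  (forall k, (0 < k <= K)%N -> (size (divisors k) <= D)%N) ->
  exists s, (0 < s)%N /\
  (\sum_(1 <= i < l.+1)
    normc (\sum_(a <= n < b) expe (i%:R * (A * n%:R ^+ 2 + B * n%:R + c)))) ^+ 2
  <= L ^+ 2 * om ^+ 3 * (X + X ^+ 2 / Num.max s%:R (X * K%:R * dist (s%:R * A))).
Proof.
move=> ab abH HX lHK K0 X0 lL KX om100 Dom hH hD.
have [s [s0 hs]] := recip_sum A K0 X0; exists s; split => //.
set t := Num.max _ _ in hs *.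
have t0 : 0 < t by rewrite /t lt_max ltr0n s0.
have om0 : 0 < om by apply: lt_le_trans om100.
have L0 : 0 <= L by apply: le_trans lL.
have bX : (b - a)%:R <= X by apply: le_trans HX; rewrite ler_nat.
have hw := @weyl_sum_multiples R A B c X a b l H K D ab X0 bX abH lHK hD.
apply: (le_trans (sqr_sum_le _ _)).
apply: (@le_trans _ _ (L * (L * om ^+ 3 * (X + X ^+ 2 / t)))); last first.
  by rewrite le_eqVlt; apply/orP; left; apply/eqP; ring.
apply: ler_pM => //; first by apply: sumr_ge0 => i _; exact: sqr_ge0.
apply: (le_trans hw).
have hK : harm R K <= om by apply: le_trans hH; apply: harm_le; rewrite leq_pmull.
have H0 n : 0 <= harm R n by rewrite /harm sumr_ge0 // => i _; rewrite invr_ge0.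
have e1 : 16 * K%:R * harm R (2 * K) + harm R K * X * K%:R / t <=
    16 * (2 * L * X) * om + om * X * (2 * L * X) / t.
  apply: lerD; first by apply: ler_pM; first [nneg | exact: H0 | by rewrite ler_pM2l].
  rewrite ler_pM2r ?invr_gt0 //.
  by apply: ler_pM; first [exact: H0 | by rewrite ler_pM2r | nneg
    | by apply: mulr_ge0; [exact: H0 | nneg]].
have S0 : 0 <= \sum_(1 <= k < K.+1) rmin X (k%:R * A).
  by apply: sumr_ge0 => k _; apply: rmin_ge0.
apply: (@le_trans _ _ (L * X + 2 * om * (16 * (2 * L * X) * om + om * X * (2 * L * X) / t))).
  apply: lerD; first by rewrite ler_pM2r.
  by apply: ler_pM; first [nneg | by rewrite ler_pM2l | exact: le_trans e1].
pose u := L * X; pose v := L * X ^+ 2 / t.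
have u0 : 0 <= u by rewrite /u; nneg.
have v0 : 0 <= v by rewrite /v; nneg.
rewrite (_ : L * X + _ = u + 64 * om ^+ 2 * u + 4 * om ^+ 2 * v); last first.
  by rewrite /u /v; field; rewrite gt_eqF.
rewrite (_ : L * om ^+ 3 * _ = om * (om ^+ 2 * u) + om * (om ^+ 2 * v)); last first.
  by rewrite /u /v; field; rewrite gt_eqF.
have o2 : 1 <= om ^+ 2 by rewrite exprn_ege1 // (le_trans _ om100) // ler1n.
have z1 : 0 <= om ^+ 2 * u by nneg.
have z2 : 0 <= om ^+ 2 * v by nneg.
have z3 : u <= om ^+ 2 * u by rewrite ler_peMl.
have z4 := ler_wpM2r z1 om100; have z5 := ler_wpM2r z2 om100.
move: z1 z2 z3 z4 z5; rewrite -!mulrA; clear; lra.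
Qed.
End Core.

(** Through powers of 2, logarithmic quantities such as the number of levels and the harmonic sums
    are bounded by the divisor function, hence by [om]. *)
Lemma ltn_size_divisors_exp2 i : (i < size (divisors (2 ^ i)))%N.
Proof.
rewrite -[X in (X <= _)%N](size_iota 0) -(size_map (fun j => 2 ^ j)%N).
apply: uniq_leq_size.
  by rewrite map_inj_uniq ?iota_uniq // => x y /eqP; rewrite eqn_exp2l // => /eqP.
move=> y /mapP[j]; rewrite mem_iota add0n ltnS => /= ji ->.
by rewrite -dvdn_divisors ?expn_gt0 // dvdn_exp2l.
Qed.

(** * Splitting by the size of [t] *)

Lemma exp4_level (R : realDomainType) (t : R) I : 1 <= t -> t < 4 ^+ I ->
  exists i, [/\ (i < I)%N, 4 ^+ i <= t & t < 4 ^+ i.+1].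
Proof.
elim: I => [|I IH] t1; first by rewrite expr0 ltNge t1.
move=> tI; have [h|h] := ltP t (4 ^+ I); last by exists I.
by have [i [iI h1 h2]] := IH t1 h; exists i; split => //; exact: ltnW.
Qed.

Lemma exp4_cover (R : realType) (x : R) : exists I : nat,
  x <= 4 ^+ I /\ forall i, (i < I)%N -> 4 ^+ i < x.
Proof.
have ex : exists n, x <= 4 ^+ n.
  exists (Num.truncn x).+1; apply: ltW; apply: (lt_le_trans (truncnS_gt x)).
  by rewrite -natrX ler_nat ltnW // ltn_expl.
exists (ex_minn ex); case: ex_minnP => I xI hmin; split => // i iI.
by rewrite ltNge; apply/negP => /hmin; rewrite leqNgt iI.
Qed.

(** The square root of the Weyl bound in the range [u^2 <= X], where the term [X] is dominated. *)
Lemma sqr_le_level (R : realFieldType) (x X L om t u : R) :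
  0 <= x -> 0 <= X -> 0 <= L -> 1 <= om -> 0 < u -> u ^+ 2 <= t ->
  X <= X ^+ 2 / u ^+ 2 ->
  x ^+ 2 <= L ^+ 2 * om ^+ 3 * (X + X ^+ 2 / t) -> x <= 2 * om ^+ 2 * L * X / u.
Proof.
move=> x0 X0 L0 om1 u0 ut Xu hx.
have om0 : 0 < om by apply: lt_le_trans om1.
have t0 : 0 < t by apply: lt_le_trans ut; pos.
rewrite -(ler_pXn2r (_ : 0 < 2)%N) ?nnegrE //; last by nneg.
apply: (le_trans hx).
have e1 : X ^+ 2 / t <= X ^+ 2 / u ^+ 2.
  by rewrite ler_wpM2l ?sqr_ge0 // lef_pV2 ?posrE //; pos.
apply: (@le_trans _ _ (L ^+ 2 * om ^+ 3 * (2 * (X ^+ 2 / u ^+ 2)))).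
  by apply: ler_wpM2l; [nneg | move: e1 Xu; clear; lra].
have -> : (2 * om ^+ 2 * L * X / u) ^+ 2 =
    L ^+ 2 * om ^+ 3 * (4 * om * (X ^+ 2 / u ^+ 2)) by field; rewrite gt_eqF.
rewrite ler_wpM2l //; first by nneg.
rewrite ler_wpM2r //; [by nneg | by move: om1; clear; lra].
Qed.

(** If [t >= 4 ^+ I], the Weyl bound already saves [om ^+ 3]. Otherwise [t] lies between consecutive
    powers of 4, and both entries of the maximum lie below the upper one, so [s] witnesses
    [near_int] at that level. Powers of 4 keep the square root of [t] a power of 2. *)
Lemma level_decomposition (R : realType) (x X L om th : R) (n K I : nat) (s : nat) :
  0 <= x -> 1 <= L -> 1 <= om -> (0 < K)%N -> (0 < s)%N ->
  L ^+ 2 * om ^+ 10 <= X ->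
  L ^+ 2 * om ^+ 10 <= 4 ^+ I -> (forall i, (i < I)%N -> 4 ^+ i < L ^+ 2 * om ^+ 10) ->
  x ^+ 2 <= L ^+ 2 * om ^+ 3 * (X + X ^+ 2 / Num.max s%:R (X * K%:R * dist (s%:R * (n%:R * th)))) ->
  x <= 2 * X / om ^+ 3 + \sum_(0 <= i < I)
    (near_int th (4 ^ i.+1) (4 ^+ i.+1 / (X * K%:R)) n)%:R * (2 * om ^+ 2 * L * X / 2 ^+ i).
Proof.
move=> x0 L1 om1 K0 s0 LX LI Li; set t := Num.max _ _ => hx.
have L0 := lt_le_trans ltr01 L1; have om0 := lt_le_trans ltr01 om1.
have X0 : 0 < X by apply: lt_le_trans LX; pos.
have KR : 0 < K%:R :> R by rewrite ltr0n.
have t1 : 1 <= t by rewrite /t le_max ler1n s0.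
have sum0 : 0 <= \sum_(0 <= i < I)
    (near_int th (4 ^ i.+1) (4 ^+ i.+1 / (X * K%:R)) n)%:R * (2 * om ^+ 2 * L * X / 2 ^+ i).
  by apply: sumr_ge0 => i _; nneg.
have first0 : 0 <= 2 * X / om ^+ 3 by nneg.
have Xsq u : 0 < u -> u ^+ 2 <= L ^+ 2 * om ^+ 10 -> X <= X ^+ 2 / u ^+ 2.
  move=> u0 hu; rewrite ler_pdivlMr ?exprn_gt0 // expr2 ler_pM2l //.
  exact: le_trans LX.
have [big|small] := leP (4 ^+ I) t.
  apply: (@le_trans _ _ (2 * X / om ^+ 3)); last by rewrite lerDl.
  have u0 : 0 < L * om ^+ 5 by pos.
  have uE : (L * om ^+ 5) ^+ 2 = L ^+ 2 * om ^+ 10 by ring.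
  have := sqr_le_level x0 (ltW X0) (ltW L0) om1 u0 _ (Xsq _ u0 _) hx.
  rewrite uE => /(_ (le_trans LI big) (lexx _)) /le_trans; apply.
  by rewrite le_eqVlt; apply/orP; left; apply/eqP; field; rewrite !gt_eqF.
have [i [iI ti1 ti2]] := exp4_level t1 small.
apply: (@le_trans _ _ (\sum_(0 <= i < I)
    (near_int th (4 ^ i.+1) (4 ^+ i.+1 / (X * K%:R)) n)%:R * (2 * om ^+ 2 * L * X / 2 ^+ i)));
  last by rewrite lerDr.
rewrite (bigD1_seq i) ?iota_uniq ?mem_index_iota //=.
have -> : near_int th (4 ^ i.+1) (4 ^+ i.+1 / (X * K%:R)) n.
  apply/near_intP; exists s; split => //.
    rewrite -(ler_nat R) natrX; apply: ltW; apply: le_lt_trans ti2.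
    by rewrite /t le_max lexx.
  rewrite natrM -mulrA ler_pdivlMr; last by pos.
  apply: ltW; apply: le_lt_trans ti2.
  by rewrite mulrC /t le_max lexx orbT.
rewrite mul1r -[leLHS]addr0; apply: lerD; last by apply: sumr_ge0 => j _; nneg.
have uE : (2 ^+ i) ^+ 2 = 4 ^+ i :> R by rewrite exprAC; congr (_ ^+ _); ring.
have u0 : 0 < 2 ^+ i :> R by rewrite exprn_gt0.
apply: sqr_le_level hx => //; rewrite ?uE //; try exact: ltW.
by have := Xsq _ u0; rewrite uE; apply; apply: ltW; exact: Li.
Qed.

Section Core.
Variable R : realType.
Local Notation normc := (@Normc.normc R).

Lemma tsum_core (a : int) (q D : nat) (beta gamma N L V W om U : R)
    (J : nat -> nat -> interval R) :
  (0 < q)%N -> coprimez a q -> 1 <= V -> 1 <= W -> 1 <= L -> 100 <= om ->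
  D%:R <= om ->
  (forall z, (0 < z)%N -> z%:R <= U -> (size (divisors z) <= D)%N) ->
  (forall n, n%:R <= U -> harm R n <= om) ->
  32 * L ^+ 2 * V ^+ 2 * W ^+ 2 * om ^+ 18 <= U ->
  4 * L * N <= U ->
  L ^+ 4 * V ^+ 3 * W ^+ 2 * om ^+ 25 <= q%:R ^+ 2 ->
  L ^+ 3 * W * om ^+ 28 <= q%:R ->
  L ^+ 6 * om ^+ 57 <= q%:R ->
  L ^+ 2 * om ^+ 10 * (V * W) <= N ->
  q%:R ^+ 2 <= L * N ^+ 2 ->
  Tsum (quad (a%:~R / q%:R) beta gamma) N L V W J <= N / om.
Proof.
move=> q0 caq V1 W1 L1 om100 Dom hD hH hU hU' h1 h2 h4 h3 h5.
have om1 : 1 <= om by apply: le_trans om100; rewrite ler1n.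
have om0 := lt_le_trans ltr01 om1.
have L0 := lt_le_trans ltr01 L1.
have V0 := lt_le_trans ltr01 V1.
have W0 := lt_le_trans ltr01 W1.
have VW1 : 1 <= V * W by rewrite -[leLHS]mulr1; apply: ler_pM.
have VW0 := lt_le_trans ltr01 VW1.
have qR : 0 < q%:R :> R by rewrite ltr0n.
pose X := N / (V * W).
have LX : L ^+ 2 * om ^+ 10 <= X by rewrite ler_pdivlMr.
have NX : X * (V * W) = N by rewrite /X divfK // gt_eqF.
have L21 : 1 <= L ^+ 2 * om ^+ 10.
  by rewrite -[leLHS]mulr1; apply: ler_pM => //; rewrite exprn_ege1.
have X1 : 1 <= X by apply: le_trans LX.
have X0 := lt_le_trans ltr01 X1.
have N0 : 0 < N by rewrite -NX; pos.
have XN : X <= N by rewrite -NX ler_peMr // ltW.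
set th : R := a%:~R / q%:R.
(* [K] covers every frequency [2 i h], and [L X >= 1] gives [L X <= K], needed later to bound the
   radius from above. *)
pose K := Num.truncn (2 * L * X); pose l := Num.truncn L; pose H := Num.truncn X.
have LX1 : 1 <= L * X by rewrite -[leLHS]mulr1; apply: ler_pM.
have KX : K%:R <= 2 * L * X by rewrite truncn_le; nneg.
have KX' : L * X <= K%:R.
  have := truncnS_gt (2 * L * X); rewrite -/K -natr1 -mulrA => h.
  by move: h LX1; clear; lra.
have K0 : (0 < K)%N by rewrite truncn_gt0 -mulrA; move: LX1; clear; lra.
have KR : 0 < K%:R :> R by rewrite ltr0n.
have lL : l%:R <= L by rewrite truncn_le ltW.
have HX : H%:R <= X by rewrite truncn_le ltW.
have lHK : (2 * l * H <= K)%N.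
  rewrite truncn_ge_nat; last by nneg.
  by rewrite !natrM; apply: ler_pM => //; rewrite ler_pM2l.
have K2U : (2 * K)%:R <= U.
  rewrite natrM; apply: le_trans hU'; apply: (@le_trans _ _ (2 * (2 * L * X))).
    by rewrite ler_pM2l.
  by rewrite [leLHS](_ : _ = 4 * L * X); [rewrite ler_pM2l //; pos | ring].
have hDK k : (0 < k <= K)%N -> (size (divisors k) <= D)%N.
  move=> /andP[k0 kK]; apply: hD => //; apply: le_trans K2U.
  by rewrite ler_nat (leq_trans kK) // leq_pmull.
have [I [LI Li]] := exp4_cover (L ^+ 2 * om ^+ 10).
pose c0 := 2 * X / om ^+ 3.
pose c i := 2 * om ^+ 2 * L * X / 2 ^+ i.
pose nr i v w := near_int th (4 ^ i.+1) (4 ^+ i.+1 / (X * K%:R)) ((v * w) ^ 2).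
have inner v w : dyadic V v -> dyadic W w ->
  \sum_(1 <= i < l.+1) normc (isum (N / (v * w)%:R) (J v w)
     (fun n => Defs.expe (i%:R * quad th beta gamma (v * w * n)%:R)))
  <= c0 + \sum_(0 <= i < I) (nr i v w)%:R * c i.
  move=> Vv Ww; have [a' [b' [ab abB hs]]] := isum_range (N / (v * w)%:R) (J v w).
  have v0 := dyadic_gt0 (ltW V0) Vv; have w0 := dyadic_gt0 (ltW W0) Ww.
  have vwR : 0 < (v * w)%:R :> R by rewrite ltr0n muln_gt0 v0.
  have abH : (b' - a' <= H)%N.
    apply: (leq_trans abB); apply: le_truncn; rewrite /X ler_pM2l //.
    rewrite lef_pV2 ?posrE // natrM; case/andP: Vv => hv _; case/andP: Ww => hw _.
    by apply: ler_pM; exact: ltW.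
  have [s [s0 hx]] := @tsum_inner R (((v * w) ^ 2)%:R * th) (beta * (v * w)%:R) gamma X
    a' b' l H K D om L ab abH HX lHK K0 X0 lL KX om100 Dom (hH _ K2U) hDK.
  apply: (@level_decomposition _ _ X L om th ((v * w) ^ 2) K I s) => //.
    by apply: sumr_ge0 => i _; exact: normc_ge0.
  move: hx; rewrite (_ : \sum_(1 <= i < l.+1) _ = \sum_(1 <= i < l.+1) normc (isum (N / (v * w)%:R)
     (J v w) (fun n => Defs.expe (i%:R * quad th beta gamma (v * w * n)%:R)))); first by exact.
  apply: eq_bigr => i _; rewrite hs; congr (normc _); apply: eq_bigr => n _.
  congr Defs.expe; congr (_ * _).
  by rewrite /quad natrX (natrM _ (v * w)%N n); ring.
rewrite /Tsum exchange_big /=.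
under eq_bigr do rewrite exchange_big /=.
apply: (@le_trans _ _ (\sum_(0 <= v < (Num.truncn (2 * V)).+1 | dyadic V v)
   \sum_(0 <= w < (Num.truncn (2 * W)).+1 | dyadic W w)
      (c0 + \sum_(0 <= i < I) (nr i v w)%:R * c i))).
  by apply: ler_sum => v Vv; apply: ler_sum => w Ww; exact: inner.
have c00 : 0 <= c0 by rewrite /c0; nneg.
rewrite (eq_bigr _ (fun v _ => big_split _ _ _ _ _)) big_split /=.
have om3 : 0 < om ^+ 3 by pos.
have part1 : \sum_(0 <= v < (Num.truncn (2 * V)).+1 | dyadic V v)
   \sum_(0 <= w < (Num.truncn (2 * W)).+1 | dyadic W w) c0 <= 8 * N / om ^+ 3.
  have -> : \sum_(0 <= v < (Num.truncn (2 * V)).+1 | dyadic V v)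
   \sum_(0 <= w < (Num.truncn (2 * W)).+1 | dyadic W w) c0 =
   c0 * ((\sum_(0 <= v < (Num.truncn (2 * V)).+1 | dyadic V v) 1) *
     (\sum_(0 <= w < (Num.truncn (2 * W)).+1 | dyadic W w) 1)).
    rewrite mulr_suml mulr_sumr; apply: eq_bigr => v _; rewrite mul1r mulr_sumr.
    by apply: eq_bigr => w _; rewrite mulr1.
  apply: (@le_trans _ _ (c0 * ((2 * V) * (2 * W)))).
    rewrite ler_wpM2l //; apply: ler_pM; try exact: sumr_ge0.
      by apply: count_dyadic; exact: ltW.
    by apply: count_dyadic; exact: ltW.
  by rewrite le_eqVlt; apply/orP; left; apply/eqP; rewrite -NX /c0; field; rewrite gt_eqF.
have part2 : \sum_(0 <= v < (Num.truncn (2 * V)).+1 | dyadic V v)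
   \sum_(0 <= w < (Num.truncn (2 * W)).+1 | dyadic W w)
     \sum_(0 <= i < I) (nr i v w)%:R * c i <= 4 * N / om ^+ 3.
  have -> : \sum_(0 <= v < (Num.truncn (2 * V)).+1 | dyadic V v)
     \sum_(0 <= w < (Num.truncn (2 * W)).+1 | dyadic W w)
       \sum_(0 <= i < I) (nr i v w)%:R * c i =
     \sum_(0 <= i < I) c i * \sum_(0 <= w < (Num.truncn (2 * W)).+1 | dyadic W w)
       \sum_(0 <= v < (Num.truncn (2 * V)).+1 | dyadic V v) (nr i v w)%:R.
    under eq_bigr do rewrite exchange_big /=.
    rewrite exchange_big /=; apply: eq_bigr => i _; rewrite exchange_big mulr_sumr /=.
    apply: eq_bigr => w _; rewrite mulr_sumr; apply: eq_bigr => v _; exact: mulrC.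
  have I4 : 4 ^+ I <= 4 * (L ^+ 2 * om ^+ 10).
    case: (I) Li => [_|I' /(_ I' (ltnSn _)) h]; last by rewrite exprS ler_pM2l // ltW.
    by rewrite expr0; move: L21; clear; lra.
  have L2U : 4 * (L ^+ 2 * om ^+ 10) <= U.
    apply: le_trans hU.
    have -> : 32 * L ^+ 2 * V ^+ 2 * W ^+ 2 * om ^+ 18 =
      4 * (L ^+ 2 * om ^+ 10) * (8 * (V ^+ 2 * (W ^+ 2 * om ^+ 8))) by ring.
    rewrite ler_peMr //; first by nneg.
    have hh x y : 1 <= x -> 1 <= y -> 1 <= x * y :> R.
      by move=> x1 y1; rewrite -[leLHS]mulr1; apply: ler_pM.
    by apply: (hh); [rewrite ler1n | apply: (hh); [|apply: (hh)]]; rewrite // exprn_ege1.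
  (* The number of levels is below d(2^I), and [2 ^ I <= 4 ^ I] stays within the range [U] of the
     divisor bound. *)
  have Iom : I%:R <= om.
    apply: le_trans Dom; rewrite ler_nat; apply: leq_trans (ltnW (ltn_size_divisors_exp2 I)) _.
    apply: hD; first by rewrite expn_gt0.
    rewrite natrX; apply: le_trans L2U; apply: le_trans I4.
    by apply: ler_expn => //; rewrite ler_nat.
  (* Every level costs the same: the factor [1 / 2 ^+ i] of [c i] cancels against [tau = 2 ^+ i.+1]
     in the count [V W tau / (L om^6)]. *)
  apply: (@le_trans _ _ (\sum_(0 <= i < I) 4 * N / om ^+ 4)).
    apply: ler_sum_nat => i /andP[_ iI].
    have t1 : 1 <= 2 ^+ i.+1 :> R by rewrite exprn_ege1 // ler1n.
    have t2E : (2 ^+ i.+1) ^+ 2 = 4 ^+ i.+1 :> R by rewrite exprAC; congr (_ ^+ _); ring.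
    have tL : 2 ^+ i.+1 <= 2 * L * om ^+ 5.
      rewrite exprS -mulrA ler_pM2l // -(ler_pXn2r (_ : 0 < 2)%N) ?nnegrE //; try by nneg.
      have -> : (2 ^+ i) ^+ 2 = 4 ^+ i :> R by rewrite exprAC; congr (_ ^+ _); ring.
      have -> : (L * om ^+ 5) ^+ 2 = L ^+ 2 * om ^+ 10 by ring.
      exact: ltW (Li _ iI).
    have T0 : (0 < 4 ^ i.+1)%N by rewrite expn_gt0.
    have Tt : (4 ^ i.+1)%:R <= (2 ^+ i.+1) ^+ 2 :> R by rewrite t2E natrX.
    have d0 : 0 < 4 ^+ i.+1 / (X * K%:R) :> R by rewrite divr_gt0 // ?exprn_gt0 //; pos.
    (* Here [X K >= L X^2], and [q^2 <= L N^2] with [N = X V W] gives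
       [1 / (L X^2) <= (V W)^2 / q^2]. *)
    have dle : 4 ^+ i.+1 / (X * K%:R) <= (2 ^+ i.+1) ^+ 2 * (V * W) ^+ 2 / q%:R ^+ 2.
      rewrite t2E -mulrA ler_pM2l ?exprn_gt0 //.
      rewrite -[leRHS]invrK lef_pV2 ?posrE ?invr_gt0 //; [|pos|pos].
      rewrite invfM invrK; apply: (@le_trans _ _ (X * (L * X))); last by rewrite ler_pM2l.
      rewrite mulrC ler_pdivrMr ?exprn_gt0 //; apply: (le_trans h5).
      by rewrite -NX le_eqVlt; apply/orP; left; apply/eqP; ring.
    have := count_near_int_vw q0 caq V1 W1 L1 om100 Dom hD hU h1 h2 h4 t1 tL T0 Tt d0 dle.
    have ci0 : 0 <= c i by rewrite /c; apply: divr_ge0; [nneg | rewrite exprn_ge0].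
    move=> /(ler_wpM2l ci0) /le_trans; apply.
    rewrite le_eqVlt; apply/orP; left; apply/eqP; rewrite -NX /c (exprS 2 i).
    have p0 : 0 < 2 ^+ i :> R by rewrite exprn_gt0.
    move: (2 ^+ i) p0 => p p0; clear -p0 L0 om0.
    by field; rewrite !gt_eqF.
  rewrite sumr_const_nat subn0 -[X in X <= _]mulr_natl.
  apply: (@le_trans _ _ (om * (4 * N / om ^+ 4))); first by rewrite ler_wpM2r //; nneg.
  by rewrite le_eqVlt; apply/orP; left; apply/eqP; field; rewrite gt_eqF.
apply: (le_trans (lerD part1 part2)).
have -> : 8 * N / om ^+ 3 + 4 * N / om ^+ 3 = 12 * N / om ^+ 3 by ring.
have -> : N / om = N * om ^+ 2 / om ^+ 3 by field; rewrite gt_eqF.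
rewrite ler_pM2r ?invr_gt0 // mulrC ler_pM2l //.
by move: om100; clear; nra.
Qed.
End Core.

(** * Choice of parameters *)

Section Asymptotics.
Variable R : realType.
Implicit Types (x y eps K N om : R).

(** By halving: the terms beyond [n./2] add up to at most 1. *)
Lemma harm_dyadic n : (0 < n)%N -> exists j, (2 ^ j <= n)%N /\ harm R n <= j.+1%:R.
Proof.
elim/ltn_ind: n => n IH n0; have [n1|n1] := leqP n 1.
  have -> : n = 1%N by lia.
  by exists 0%N; split => //; rewrite /harm big_nat1 invr1.
have [|//|j [j1 j2]] := IH n./2; [lia|lia|].
exists j.+1; split; first by rewrite expnS; lia.
rewrite /harm (big_cat_nat (n := n./2.+1)) //=; last by lia.
rewrite -natr1; apply: lerD => //.
apply: (@le_trans _ _ (\sum_(n./2.+1 <= i < n.+1) (n./2.+1)%:R^-1)).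
  apply: ler_sum_nat => i /andP[i1 i2].
  by rewrite lef_pV2 ?posrE ?ltr0n ?ler_nat //; lia.
rewrite sumr_const_nat -[X in X <= _]mulr_natl ler_pdivrMr ?ltr0n // mul1r ler_nat; lia.
Qed.

Lemma harm_le_divisors (B U : R) : 1 <= B ->
  (forall z, (0 < z)%N -> z%:R <= U -> (size (divisors z))%:R <= B) ->
  forall n, n%:R <= U -> harm R n <= B.
Proof.
move=> B1 hB n nU; have [->|n0] := posnP n.
  by rewrite /harm big_geq // (le_trans ler01).
have [j [j1 j2]] := harm_dyadic n0; apply: (le_trans j2).
apply: (le_trans _ (hB (2 ^ j)%N _ _)); rewrite ?expn_gt0 //.
  by rewrite ler_nat ltn_size_divisors_exp2.
by apply: le_trans nU; rewrite ler_nat.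
Qed.

(** With [k > (m + 1) / c], the [k]-th power of d(z) is at most [N ^ m] times a constant; for [N]
    beyond that constant it is at most [N ^ (m + 1)], hence at most [N ^ (c k)]. *)
Lemma divisor_bound (c : R) (m : nat) : 0 < c -> exists M : R, forall N, M <= N -> 1 <= N ->
  forall z, (0 < z)%N -> z%:R <= N ^+ m -> (size (divisors z))%:R <= N `^ c.
Proof.
move=> c0; pose k := (Num.truncn (m.+1%:R / c)).+1.
exists ((k ^ k) ^ (2 ^ k))%:R => N MN N1 z z0 zN.
have N0 := lt_le_trans ltr01 N1.
rewrite -(ler_pXn2r (_ : 0 < k)%N) ?nnegrE ?powR_ge0 //.
have := size_divisors_exp_le (ltn0Sn _ : 0 < k)%N z0; rewrite -(ler_nat R) natrM natrX.
move=> /le_trans; apply; apply: (@le_trans _ _ (N ^+ m * N)); first exact: ler_pM.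
rewrite -exprSr -(powR_mulrn _ (powR_ge0 _ _)) -powRrM -(powR_mulrn _ (ltW N0)).
apply: ler_powR => //; rewrite mulrC -ler_pdivrMr //; apply: ltW; exact: truncnS_gt.
Qed.

(** The condition [100 * (1 + K) ^+ 4 <= om] absorbs every power of [K] and numerical factor below
    at the price of one [om]; what remains is a comparison of exponents of [N], linear in [rho] and
    [eps]. *)
Lemma tsum_bound (a : int) (q : nat) (beta gamma rho eps K N V W : R)
    (J : nat -> nat -> interval R)
    (L1 := 2 * N `^ (rho - eps / 2)) (L := N `^ (rho - eps / 3)) (om := N `^ (eps / 100)) :
  1 / 6 < rho < 2 / 11 -> 0 < eps -> eps < 1 / 10 -> 0 < K -> 1 <= N ->
  100 * (1 + K) ^+ 4 <= om ->
  (forall z, (0 < z)%N -> z%:R <= N ^+ 23 -> (size (divisors z))%:R <= om) ->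
  (0 < q)%N -> coprimez a q ->
  L1 `^ (1 / 2) * N <= K * q%:R -> q%:R <= K * (L1 `^ (1 / 2) * N) ->
  1 <= V -> 1 <= W ->
  V ^+ 3 * W ^+ 2 <= K * N `^ (2 - 3 * rho) ->
  V * W ^+ 3 <= K * N `^ (3 - 15 * rho / 2) ->
  V * W <= K * N `^ (2 - 8 * rho) ->
  Tsum (quad (a%:~R / q%:R) beta gamma) N L V W J <= N / om.
Proof.
move=> /andP[rho1 rho2] eps0 eps1 K0 N1 omK hdiv q0 caq hq1 hq2 V1 W1 c1 c2 c3.
have LE : L = N `^ (rho - eps / 3) by [].
have omE : om = N `^ (eps / 100) by [].
clearbody L om.
have N0 := lt_le_trans ltr01 N1.
have N00 : N != 0 by rewrite gt_eqF.
have PD x y : N `^ x * N `^ y = N `^ (x + y) by rewrite powRD // N00 implybT.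
have PX x n : (N `^ x) ^+ n = N `^ (x * n%:R) by rewrite powRrM powR_mulrn // powR_ge0.
have Pmono x y : x <= y -> N `^ x <= N `^ y by apply: ler_powR.
have P0 x : 0 < N `^ x by apply: powR_gt0.
have P1 x : 0 <= x -> 1 <= N `^ x by move=> x0; rewrite -(powRr0 N); apply: Pmono.
have NE : N = N `^ 1 by rewrite powRr1 // ltW.
have qR : 0 < q%:R :> R by rewrite ltr0n.
have V0 := lt_le_trans ltr01 V1; have W0 := lt_le_trans ltr01 W1.
have om100 : 100 <= om.
  apply: le_trans omK; rewrite ler_peMr // exprn_ege1 //; move: K0; clear; lra.
have om1 : 1 <= om by apply: le_trans om100; rewrite ler1n.
have om0 := lt_le_trans ltr01 om1.
have K4 : 100 * K ^+ 4 <= om.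
  apply: le_trans omK; rewrite ler_pM2l //; apply: ler_expn; first exact: ltW.
  by rewrite lerDr.
have K1om : 100 * (1 + K) <= om.
  apply: le_trans omK; rewrite ler_pM2l // -[leLHS]expr1 ler_weXn2l //.
  by move: K0; clear; lra.
have Kom : K <= om by move: K1om K0; clear; lra.
have K3om : K ^+ 3 <= om.
  apply: le_trans omK; apply: (@le_trans _ _ ((1 + K) ^+ 3)).
    by apply: ler_expn; [exact: ltW | rewrite lerDr].
  apply: (@le_trans _ _ ((1 + K) ^+ 4)).
    by rewrite ler_weXn2l //; move: K0; clear; lra.
  by rewrite ler_peMl // ?ler1n // exprn_ge0 //; move: K0; clear; lra.
have K2om : 4 * K ^+ 2 <= om.
  apply: le_trans omK; apply: (@le_trans _ _ (4 * (1 + K) ^+ 4)); last first.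
    by rewrite ler_pM2r ?ler_nat //; apply: exprn_gt0; move: K0; clear; lra.
  rewrite ler_pM2l //; apply: (@le_trans _ _ ((1 + K) ^+ 2)).
    by apply: ler_expn; [exact: ltW | rewrite lerDr].
  by rewrite ler_weXn2l //; move: K0; clear; lra.
have K4om : K ^+ 4 <= om.
  by apply: le_trans K4; rewrite ler_peMl ?ler1n // exprn_ge0 // ltW.
have KqP : N `^ (1 + rho / 2 - eps / 4) <= K * q%:R.
  apply: le_trans hq1.
  have -> : N `^ (1 + rho / 2 - eps / 4) = (N `^ (rho - eps / 2)) `^ (1 / 2) * N.
    by rewrite -powRrM [in RHS]NE -powRrM PD; congr (_ `^ _); field.
  rewrite ler_pM2r //; apply: ge0_ler_powR; rewrite ?nnegrE ?powR_ge0 //.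
    by rewrite mulr_ge0 // powR_ge0.
  by rewrite ler_peMl ?powR_ge0 // ler1n.
have qP : q%:R <= 2 * K * N `^ (1 + rho / 2 - eps / 4).
  apply: (le_trans hq2).
  have -> : 2 * K * N `^ (1 + rho / 2 - eps / 4) = K * (2 * (N `^ (rho - eps / 2)) `^ (1 / 2) * N).
    have -> : N `^ (1 + rho / 2 - eps / 4) = (N `^ (rho - eps / 2)) `^ (1 / 2) * N.
      by rewrite -powRrM [in RHS]NE -powRrM PD; congr (_ `^ _); field.
    by ring.
  rewrite ler_pM2l // ler_pM2r // /L1 powRM ?powR_ge0 // ler_pM2r ?powR_gt0 //.
  by apply: ler1_powR; rewrite ?ler1n //; lra.
have L1' : 1 <= L by rewrite LE; apply: P1; lra.
have L0 := lt_le_trans ltr01 L1'.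
have h3 : L ^+ 2 * om ^+ 10 * (V * W) <= N.
  apply: (@le_trans _ _ (L ^+ 2 * om ^+ 10 * (om * N `^ (2 - 8 * rho)))).
    rewrite ler_pM2l; last by pos.
    by apply: (le_trans c3); rewrite ler_pM2r.
  by rewrite LE omE !PX !PD [leRHS]NE; apply: Pmono; lra.
have LN : L <= N by rewrite LE [leRHS]NE; apply: Pmono; lra.
have omN : om <= N by rewrite omE [leRHS]NE; apply: Pmono; lra.
have VWN : V * W <= N.
  apply: le_trans h3; rewrite ler_peMl //; first by nneg.
  by rewrite -[leLHS]mulr1; apply: ler_pM; rewrite // exprn_ege1.
(* The exponent 23 is 19 + 4: [32 om^18 <= om^19 <= N^19] and [L^2 (V W)^2 <= N^4]. *)
have hU : 32 * L ^+ 2 * V ^+ 2 * W ^+ 2 * om ^+ 18 <= N ^+ 23.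
  have -> : 32 * L ^+ 2 * V ^+ 2 * W ^+ 2 * om ^+ 18 =
    (32 * om ^+ 18) * (L ^+ 2 * (V * W) ^+ 2) by ring.
  rewrite (exprD N 19 4) (exprD N 2 2); apply: ler_pM; try by nneg.
    apply: (@le_trans _ _ (om * om ^+ 18)).
      by rewrite ler_pM2r; [move: om100; clear; lra | pos].
    by rewrite -exprS; apply: ler_expn => //; exact: ltW.
  by apply: ler_pM; first [nneg | apply: ler_expn => //; nneg].
have hU' : 4 * L * N <= N ^+ 23.
  apply: (@le_trans _ _ (N ^+ 3)); last by rewrite ler_weXn2l.
  rewrite exprSr ler_pM2r // expr2; apply: ler_pM => //; first exact: ltW.
  by apply: le_trans omN; move: om100; clear; lra.
have h1 : L ^+ 4 * V ^+ 3 * W ^+ 2 * om ^+ 25 <= q%:R ^+ 2.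
  rewrite -(ler_pM2l (_ : 0 < K ^+ 2)) ?exprn_gt0 // -exprMn.
  apply: (@le_trans _ _ (N `^ (1 + rho / 2 - eps / 4) ^+ 2)); last first.
    by apply: ler_expn => //; exact: ltW.
  have -> : K ^+ 2 * (L ^+ 4 * V ^+ 3 * W ^+ 2 * om ^+ 25) =
     (K ^+ 2 * L ^+ 4 * om ^+ 25) * (V ^+ 3 * W ^+ 2) by ring.
  apply: (@le_trans _ _ ((K ^+ 2 * L ^+ 4 * om ^+ 25) * (K * N `^ (2 - 3 * rho)))).
    by rewrite ler_pM2l //; pos.
  have -> : (K ^+ 2 * L ^+ 4 * om ^+ 25) * (K * N `^ (2 - 3 * rho)) =
     K ^+ 3 * (L ^+ 4 * om ^+ 25 * N `^ (2 - 3 * rho)) by ring.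
  apply: (@le_trans _ _ (om * (L ^+ 4 * om ^+ 25 * N `^ (2 - 3 * rho)))).
    by rewrite ler_pM2r //; pos.
  by rewrite LE omE !PX !PD; apply: Pmono; lra.
(* Compared after cubing, where [W^3 <= V W^3] meets the hypothesis without a cube root. *)
have h2 : L ^+ 3 * W * om ^+ 28 <= q%:R.
  rewrite -(ler_pM2l K0) -(ler_pXn2r (_ : 0 < 3)%N) ?nnegrE //; try by nneg.
  apply: (@le_trans _ _ (N `^ (1 + rho / 2 - eps / 4) ^+ 3)); last first.
    by apply: ler_expn => //; exact: ltW.
  have -> : (K * (L ^+ 3 * W * om ^+ 28)) ^+ 3 = (K ^+ 3 * L ^+ 9 * om ^+ 84) * W ^+ 3 by ring.
  apply: (@le_trans _ _ ((K ^+ 3 * L ^+ 9 * om ^+ 84) * (K * N `^ (3 - 15 * rho / 2)))).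
    rewrite ler_pM2l; last by pos.
    by apply: le_trans c2; rewrite ler_peMl // exprn_ge0 // ltW.
  have -> : (K ^+ 3 * L ^+ 9 * om ^+ 84) * (K * N `^ (3 - 15 * rho / 2)) =
     K ^+ 4 * (L ^+ 9 * om ^+ 84 * N `^ (3 - 15 * rho / 2)) by ring.
  apply: (@le_trans _ _ (om * (L ^+ 9 * om ^+ 84 * N `^ (3 - 15 * rho / 2)))).
    by rewrite ler_pM2r //; pos.
  by rewrite LE omE !PX !PD; apply: Pmono; lra.
have h4 : L ^+ 6 * om ^+ 57 <= q%:R.
  rewrite -(ler_pM2l K0); apply: le_trans KqP.
  apply: (@le_trans _ _ (om * (L ^+ 6 * om ^+ 57))); first by rewrite ler_pM2r //; pos.
  by rewrite LE omE !PX !PD; apply: Pmono; lra.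
have h5 : q%:R ^+ 2 <= L * N ^+ 2.
  apply: (@le_trans _ _ ((2 * K * N `^ (1 + rho / 2 - eps / 4)) ^+ 2)).
    by apply: ler_expn.
  have -> : (2 * K * N `^ (1 + rho / 2 - eps / 4)) ^+ 2 =
    4 * K ^+ 2 * N `^ (1 + rho / 2 - eps / 4) ^+ 2 by ring.
  apply: (@le_trans _ _ (om * N `^ (1 + rho / 2 - eps / 4) ^+ 2)).
    by rewrite ler_pM2r //; pos.
  have -> : N ^+ 2 = N `^ 2 by rewrite powR_mulrn // ltW.
  by rewrite LE omE !PX !PD; apply: Pmono; lra.
apply: (@tsum_core R a q (Num.truncn om) beta gamma N L V W om (N ^+ 23) J) => //.
- by rewrite truncn_le ltW.
- by move=> z z0 zU; rewrite truncn_ge_nat; [exact: hdiv | exact: ltW].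
- exact: harm_le_divisors.
Qed.
End Asymptotics.

Theorem theorem2 (R : realType) :
  exists eps0 : R -> R,
    (forall rho : R, 1 / 6 < rho < 2 / 11 -> 0 < eps0 rho) /\
    forall eps : R, 0 < eps ->
    forall K : R, 0 < K ->
    exists C : R,
    forall rho : R, 1 / 6 < rho < 2 / 11 -> eps < eps0 rho ->
    forall alpha beta gamma : R, irrational alpha ->
    exists q0 : nat,
    forall (a : int) (q : nat),
      (q0 <= q)%N -> (0 < q)%N -> coprimez a q ->
      `|alpha - a%:~R / q%:R| < q%:R ^- 2 ->
    forall N : R, 0 < N ->
    let eta := eps ^+ 9 in
    let g := quad (a%:~R / q%:R) beta gamma in
    let L1 := 2 * N `^ (rho - eps / 2) in
    let L := N `^ (rho - eps / 3) in
      vino K (L1 `^ (1 / 2) * N) q%:R ->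
      vino K q%:R (L1 `^ (1 / 2) * N) ->
    forall V W : R, 1 <= V -> 1 <= W ->
      vino K (V ^+ 3 * W ^+ 2) (N `^ (2 - 3 * rho)) ->
      vino K (V * W ^+ 3) (N `^ (3 - 15 * rho / 2)) ->
      vino K (V * W) (N `^ (2 - 8 * rho)) ->
    forall I : nat -> nat -> interval R,
      (forall v w : nat, dyadic V v -> dyadic W w ->
         {subset I v w <= `]N / (2 * v%:R * w%:R), N / (v%:R * w%:R)]}) ->
      vino C (Tsum g N L V W I) (N `^ (1 - 10 * eta)).
Proof.
exists (fun _ => 1 / 10); split; first by move=> _ _; lra.
(* [C = 1] suffices: [q >= q0] forces [N] to be large, and [om] then absorbs all constants, [K]
   included. *)
move=> eps eps0 K K0; exists 1 => rho hrho eps1 alpha beta gamma _.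
have c0 : 0 < eps / 100 by rewrite divr_gt0.
have [M hM] := divisor_bound 23 c0.
(* Beyond [N0] the divisor bound holds and [om >= 100 (1 + K)^4]. *)
pose N0 := Num.max 1 (Num.max M ((100 * (1 + K) ^+ 4) `^ (eps / 100)^-1)).
have N01 : 1 <= N0 by rewrite /N0 le_max lexx.
(* If [N < N0], then [L1^(1/2) <= 2 N0], hence [q <= K * (2 * N0 * N0)]; a larger [q] therefore
   forces [N >= N0]. *)
exists (Num.truncn (K * (2 * N0 * N0))).+1 => a q hq q0 caq _ N N_gt0 eta g L1 L hq1 hq2.
move=> V W V1 W1 hV1 hV2 hV3 I _.
have drop (A B : R) : 0 <= A -> vino K A B -> A <= K * B.
  by rewrite /vino => A0; rewrite ger0_norm.
have V0 := lt_le_trans ltr01 V1; have W0 := lt_le_trans ltr01 W1.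
have {}hq1 := drop _ _ (mulr_ge0 (powR_ge0 _ _) (ltW N_gt0)) hq1.
have {}hq2 := drop _ _ (ler0n _ _) hq2.
have NN0 : N0 <= N.
  rewrite leNgt; apply/negP => NN0.
  have : q%:R <= K * (2 * N0 * N0).
    apply: (le_trans hq2); rewrite ler_pM2l //.
    apply: ler_pM => //; first [exact: powR_ge0 | exact: ltW | idtac].
    rewrite /L1; have e1 : N `^ (rho - eps / 2) <= N0.
      apply: (@le_trans _ _ (N0 `^ (rho - eps / 2))).
        apply: ge0_ler_powR; rewrite ?nnegrE //; try (by apply: ltW); try lra.
      by apply: ler1_powR => //; lra.
    apply: (@le_trans _ _ ((2 * N0) `^ (1 / 2))).
      by apply: ge0_ler_powR; rewrite ?nnegrE;
        first [lra | by rewrite mulr_ge0 ?powR_ge0 | by rewrite ler_pM2l].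
    by apply: ler1_powR; lra.
  by rewrite leNgt => /negP; apply; apply: (lt_le_trans (truncnS_gt _)); rewrite ler_nat.
have N1 : 1 <= N by apply: le_trans NN0.
have omK : 100 * (1 + K) ^+ 4 <= N `^ (eps / 100).
  have b0 : 0 <= 100 * (1 + K) ^+ 4 by rewrite mulr_ge0 // exprn_ge0 // addr_ge0 // ltW.
  have h : (100 * (1 + K) ^+ 4) `^ (eps / 100)^-1 <= N.
    by apply: le_trans NN0; rewrite /N0 !le_max lexx !orbT.
  have := ge0_ler_powR (ltW c0) _ _ h; rewrite -powRrM mulVf ?gt_eqF // powRr1 //.
  by apply; rewrite nnegrE ?powR_ge0 // ltW.
have MN : M <= N by apply: le_trans NN0; rewrite /N0 !le_max lexx !orbT.
rewrite /vino mul1r ger0_norm; last first.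
  rewrite /Tsum; apply: sumr_ge0 => l _; apply: sumr_ge0 => v _.
  by apply: sumr_ge0 => w _; exact: normc_ge0.
have hV1' := drop _ _ (mulr_ge0 (exprn_ge0 3 (ltW V0)) (exprn_ge0 2 (ltW W0))) hV1.
have hV2' := drop _ _ (mulr_ge0 (ltW V0) (exprn_ge0 3 (ltW W0))) hV2.
have hV3' := drop _ _ (mulr_ge0 (ltW V0) (ltW W0)) hV3.
apply: (le_trans (tsum_bound beta gamma I hrho eps0 eps1 K0 N1 omK (hM N MN N1)
   q0 caq hq1 hq2 V1 W1 hV1' hV2' hV3')).
rewrite -[leLHS](_ : N `^ (1 - eps / 100) = _); last first.
  by rewrite powRB; [rewrite powRr1 // ltW | apply/implyP => _; rewrite gt_eqF].
apply: ler_powR => //; rewrite lerD2l lerN2 /eta.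
(* Here [eps < 1 / 10] gives [10 eps^8 <= 1 / 100], so [10 eta <= eps / 100]: the saving [om] covers
   [N^(10 eta)]. *)
have e8 : eps ^+ 8 <= (1 / 10) ^+ 3.
  apply: (@le_trans _ _ (eps ^+ 3)); last by apply: ler_expn; exact: ltW.
  by rewrite ler_wiXn2l //; lra.
have -> : 10 * eps ^+ 9 = eps * (10 * eps ^+ 8) by ring.
rewrite ler_pM2l //; apply: (@le_trans _ _ (10 * (1 / 10) ^+ 3)); first by rewrite ler_pM2l.
lra.
Qed.
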